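(* Let $q$ be even with $q>2$, and let $\Sigma_\infty$ be a hyperplane of $\mathrm{PG}(4,q)$ (the hyperplane at infinity); points of $\mathrm{PG}(4,q)\setminus\Sigma_\infty$ are called affine points. Let $\mathcal{C}$ be a set of $q^2$ affine points, called $\mathcal{C}$-points, and consider a set of planes of $\mathrm{PG}(4,q)$, called $\mathcal{C}$-planes, satisfying: (A1) each $\mathcal{C}$-plane meets $\mathcal{C}$ in a $q$-arc; (A2) any two distinct $\mathcal{C}$-points lie in a unique $\mathcal{C}$-plane; (A3) every affine point that is not in $\mathcal{C}$ lies on exactly one $\mathcal{C}$-plane; (A4) every plane which meets $\mathcal{C}$ in at least three points either meets $\mathcal{C}$ in exactly four points or is a $\mathcal{C}$-plane. Then there exists a regular spread $\mathcal{S}$ of $\Sigma_\infty$ such that in the Bruck–Bose plane $\mathcal{P}(\mathcal{S})\cong\mathrm{PG}(2,q^2)$, the $\mathcal{C}$-points together with two extra points on the line at infinity $\ell_\infty$ form a translation hyperoval of $\mathrm{PG}(2,q^2)$.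
   Context: A $k$-arc is a set of $k$ points of a plane, no three collinear. A spread of $\Sigma_\infty\cong\mathrm{PG}(3,q)$ is a set of $q^2+1$ pairwise disjoint lines partitioning its points; it is regular if for any three of its lines, the regulus they determine is contained in the spread. Bruck–Bose plane: given a spread $\mathcal{S}$ of $\Sigma_\infty$, $\mathcal{P}(\mathcal{S})$ is the projective plane whose affine points are the affine points of $\mathrm{PG}(4,q)$, whose affine lines are the planes of $\mathrm{PG}(4,q)$ not contained in $\Sigma_\infty$ that contain a line of $\mathcal{S}$, completed by a line at infinity $\ell_\infty$ whose points are the lines of $\mathcal{S}$ (a line of $\mathcal{S}$ is incident with the affine planes containing it); incidence between affine points and affine lines is inclusion. $\mathcal{P}(\mathcal{S})\cong\mathrm{PG}(2,q^2)$ iff $\mathcal{S}$ is regular. Writing $q=2^h$, a translation hyperoval of $\mathrm{PG}(2,q^2)$ is a set projectively equivalent to $\{(t^{2^n},t,1): t\in\mathrm{GF}(q^2)\}\cup\{(1,0,0),(0,1,0)\}$ for some integer $n$ with $\gcd(n,2h)=1$. *)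

(* Defs.v *)
From HB Require Import structures.
From mathcomp Require Import all_boot all_order all_algebra.

Set Implicit Arguments.
Unset Strict Implicit.
Unset Printing Implicit Defensive.

Import GRing.Theory.
Local Open Scope ring_scope.

HB.instance Definition _ (F : finFieldType) (V : vectType F) :=
  CanIsCountable (@VectorInternalTheory.vs2mxK F V).
HB.instance Definition _ (F : finFieldType) (V : vectType F) :
    isFinite {vspace V} :=
  CanIsFinite (@VectorInternalTheory.vs2mxK F V).

(* [d] is the projective dimension. *)
Record flat (F : finFieldType) (n d : nat) := Flat {
  flat_val :> {vspace 'rV[F]_n.+1};
  _ : \dim flat_val == d.+1
}.

HB.instance Definition _ (F : finFieldType) (n d : nat) :=
  [isSub for @flat_val F n d].
HB.instance Definition _ (F : finFieldType) (n d : nat) :=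
  [Finite of flat F n d by <:].

Notation pg_point F n := (flat F n 0).
Notation pg_line F n := (flat F n 1).
Notation pg_plane F n := (flat F n 2).
Notation pg_solid F n := (flat F n 3).

Record affine_point (F : finFieldType) (Sigma : pg_solid F 4) := AffinePoint {
  affine_val :> pg_point F 4;
  _ : ~~ (affine_val <= Sigma)%VS
}.

HB.instance Definition _ (F : finFieldType) (Sigma : pg_solid F 4) :=
  [isSub for @affine_val F Sigma].
HB.instance Definition _ (F : finFieldType) (Sigma : pg_solid F 4) :=
  [Finite of affine_point Sigma by <:].

Definition plane_section (F : finFieldType) (Sigma : pg_solid F 4)
    (C : {set affine_point Sigma}) (alpha : pg_plane F 4) : {set pg_point F 4} :=
  [set affine_val P | P in C & (P <= alpha)%VS].

Definition collinear (F : finFieldType) (n : nat) (P Q R : pg_point F n) : Prop :=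
  exists l : pg_line F n, [/\ (P <= l)%VS, (Q <= l)%VS & (R <= l)%VS].

Definition is_arc (F : finFieldType) (n k : nat) (alpha : pg_plane F n)
    (A : {set pg_point F n}) : Prop :=
  [/\ #|A| = k,
      forall P, P \in A -> (P <= alpha)%VS
    & forall P Q R, P \in A -> Q \in A -> R \in A ->
        P != Q -> P != R -> Q != R -> ~ collinear P Q R].

Section Spreads.

Variables (F : finFieldType) (Sigma : pg_solid F 4).

Definition is_spread (S : {set pg_line F 4}) : Prop :=
  [/\ forall l, l \in S -> (l <= Sigma)%VS,
      #|S| = (#|F| ^ 2 + 1)%N,
      forall l m, l \in S -> m \in S -> l != m -> (l :&: m = 0)%VS
    & forall P : pg_point F 4, (P <= Sigma)%VS ->
        exists2 l, l \in S & (P <= l)%VS].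

Definition meets (l m : pg_line F 4) : bool := (l :&: m != 0)%VS.

(* For pairwise disjoint l1, l2, l3, the q + 1 lines of Sigma meeting all three
   form the opposite regulus; the regulus determined by l1, l2, l3 consists of
   the q + 1 lines of Sigma that meet every line of the opposite regulus. *)
Definition opposite_regulus (l1 l2 l3 : pg_line F 4) : {set pg_line F 4} :=
  [set m : pg_line F 4 |
    [&& (m <= Sigma)%VS, meets m l1, meets m l2 & meets m l3]].

Definition regulus (l1 l2 l3 : pg_line F 4) : {set pg_line F 4} :=
  [set l : pg_line F 4 | (l <= Sigma)%VS &&
    [forall m in opposite_regulus l1 l2 l3, meets l m]].

Definition is_regular_spread (S : {set pg_line F 4}) : Prop :=
  is_spread S /\
  forall l1 l2 l3, l1 \in S -> l2 \in S -> l3 \in S ->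
    l1 != l2 -> l1 != l3 -> l2 != l3 -> regulus l1 l2 l3 \subset S.

End Spreads.

Record incidence_structure := IncidenceStructure {
  ipoint : finType;
  iline : finType;
  incident : ipoint -> iline -> bool
}.

Definition is_isomorphism (G H : incidence_structure)
    (f : ipoint G -> ipoint H) (g : iline G -> iline H) : Prop :=
  [/\ bijective f, bijective g
    & forall P l, incident (f P) (g l) = incident P l].

Definition PG2 (K : finFieldType) : incidence_structure :=
  @IncidenceStructure (pg_point K 2) (pg_line K 2) (fun P l => (P <= l)%VS).

Section BruckBose.

Variables (F : finFieldType) (Sigma : pg_solid F 4) (S : {set pg_line F 4}).

Record spread_line := SpreadLine {
  spread_val :> pg_line F 4;
  _ : spread_val \in S
}.
HB.instance Definition _ := [isSub for spread_val].
HB.instance Definition _ := [Finite of spread_line by <:].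

Record bb_affine_line := BBAffineLine {
  bb_plane :> pg_plane F 4;
  _ : ~~ (bb_plane <= Sigma)%VS && [exists l in S, (l <= bb_plane)%VS]
}.
HB.instance Definition _ := [isSub for bb_plane].
HB.instance Definition _ := [Finite of bb_affine_line by <:].

Definition bb_point : finType := (affine_point Sigma + spread_line)%type.

(* [None] is the line at infinity. *)
Definition bb_line : finType := option bb_affine_line.

Definition bb_incident (P : bb_point) (l : bb_line) : bool :=
  match P, l with
  | inl P, Some alpha => (P <= alpha)%VS
  | inl _, None => false
  | inr m, Some alpha => (m <= alpha)%VS
  | inr _, None => true
  end.

Definition bruck_bose : incidence_structure :=
  @IncidenceStructure bb_point bb_line bb_incident.

Definition with_two_infinite_points (C : {set affine_point Sigma})
    (A B : spread_line) : {set ipoint bruck_bose} :=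
  [set inl P | P in C] :|: [set inr A; inr B].

End BruckBose.

Section TranslationHyperovals.

Variable K : finFieldType.

Definition vec3 (x y z : K) : 'rV[K]_3 := \row_(i < 3) [:: x; y; z]`_i.
Arguments vec3 (x y z)%_R.

Definition standard_translation_hyperoval (n : nat) : {set pg_point K 2} :=
  [set P : pg_point K 2 |
    [|| [exists t : K, (P : {vspace _}) == <[vec3 (t ^+ (2 ^ n)) t 1]>%VS],
        (P : {vspace _}) == <[vec3 1 0 0]>%VS
      | (P : {vspace _}) == <[vec3 0 1 0]>%VS]].

Definition projectivity_image (M : 'M[K]_3) (X : {set pg_point K 2}) :
    {set pg_point K 2} :=
  [set P : pg_point K 2 |
    [exists Q in X, (P : {vspace _}) == (linfun (mulmxr M) @: Q)%VS]].

(* Meant for #|K| = (2 ^ h) ^ 2. As t |-> t ^ (2 ^ n) then depends only on n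
   modulo 2h, natural exponents n account for all integers. *)
Definition is_translation_hyperoval (h : nat) (X : {set pg_point K 2}) : Prop :=
  exists n : nat, gcdn n (2 * h) = 1%N /\
  exists2 M : 'M[K]_3, M \in unitmx &
    X = projectivity_image M (standard_translation_hyperoval n).

End TranslationHyperovals.

(* Main.v *)
(* Take a C-point as origin and identify the affine points with the vectors of
   Sigma, so that C becomes a set D of q^2 vectors.  If a, b, d in D are not in a
   common C-plane, (A4) gives a fourth point e of D in their plane; two chords
   meeting off D would by (A3) lie in one C-plane, so opposite chords are parallel
   and e = a + b + d.  Hence D is an additive group.  The C-planes through 0 are
   pairwise disjoint subspaces, each meeting D in a group of order q with two
   missing directions <p>, <r>.  Projecting one such subspace onto another along a
   third preserves D, and the resulting self-maps are diagonal in the basis p, r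
   and transitive on the nonzero points of D.  So D meets the subspace in
   {theta(x) p + x r} for a field automorphism theta fixing only 0 and 1, and D is
   the sum of two such groups.  Then theta is x |-> x^(2^n) with n prime to 2h,
   and a semilinear identification of the affine space with GF(q^2)^2 sends D to
   {(t^(2^n), t)}; the spread consists of the preimages of the points at
   infinity. *)
Require Import Defs.
From HB Require Import structures.
From mathcomp Require Import all_boot all_order all_algebra all_fingroup.
From mathcomp Require Import cyclic finfield.

Set Implicit Arguments.
Unset Strict Implicit.
Unset Printing Implicit Defensive.

Import GRing.Theory.
Local Open Scope ring_scope.

(** * Finite fields *)

(** The engine of the geometry is (A3) together with q > 2: a line holds at most two points of D, so
    two C-planes sharing an affine line also share a point off D and coincide. The case of three
    points in a common C-plane escapes (A4) and is reduced to the other one through an auxiliary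
    point off that plane. Theta is multiplicative because a diagonal self-map of D taking p + r to
    theta(x) p + x r has entries theta(x), x, so applying it multiplies the parameters. One theta
    serves both summands of D because the second is the image of the first under a projection
    preserving D. [K] is known only by its order, so an embedding of [F] has to be built; and the
    exponent of theta, which on [F] counts modulo h, must be chosen odd to be prime to 2h on [K]. *)

Lemma finField_generator (F : finFieldType) :
  exists z : F, [/\ z != 0, forall x, x != 0 -> exists i, x = z ^+ i
    & forall n, z ^+ n = 1 -> (#|F|.-1 %| n)%N].
Proof.
have /cyclicP[u defu] := field_unit_group_cyclic [set: {unit F}]%G.
exists (val u); split=> [|x x0|n zn1].
- by rewrite -unitfE (valP u).
- have ux : x \is a GRing.unit by rewrite unitfE.
  have /cycleP[i xi]: Sub x ux \in <[u]>%g by rewrite -defu inE.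
  by exists i; rewrite -FinRing.val_unitX -xi.
- rewrite -card_finField_unit defu -[#|_|]/#[u]%g order_dvdn.
  by apply/eqP/val_inj; rewrite FinRing.val_unitX zn1.
Qed.

(** A generator [z] of the multiplicative group has a minimal polynomial [m] over the prime field.
    It divides ['X^(#|K|) - 'X], which splits in [K], so [m] has a root [eta] there, and f(z) goes
    to f(eta). *)
Lemma finField_embedding (p h l : nat) (F K : finFieldType) :
  prime p -> #|F| = (p ^ h)%N -> #|K| = (#|F| ^ l)%N ->
  inhabited {rmorphism F -> K}.
Proof.
move=> p_pr cF cK.
have cFp : p \in [pchar F] := card_finPcharP cF p_pr.
have cKp : p \in [pchar K].
  by apply: (@card_finPcharP _ p (h * l)) => //; rewrite cK cF expnM.
have [iF _] : exists iF : {rmorphism 'F_p -> F}, True.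
  by exists (GRing.in_alg (pPrimeCharType cFp) : {rmorphism 'F_p -> pPrimeCharType cFp}).
have [iK _] : exists iK : {rmorphism 'F_p -> K}, True.
  by exists (GRing.in_alg (pPrimeCharType cKp) : {rmorphism 'F_p -> pPrimeCharType cKp}).
have [z [z0 zgen _]] := finField_generator F.
pose Xq : {poly 'F_p} := 'X^(#|K|) - 'X.
have Xq0 : Xq != 0.
  rewrite -size_poly_gt0 size_polyDl size_polyXn // size_polyN size_polyX ltnS.
  exact: finNzRing_gt1.
have Xqz : root (map_poly iF Xq) z.
  rewrite /Xq rmorphB /= map_polyXn map_polyX rootE !hornerE cK.
  suff -> : z ^+ (#|F| ^ l) = z by rewrite subrr.
  by elim: l {cK} => [|l IH]; rewrite ?expn0 ?expr1 // expnSr exprM IH expf_card.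
have [m [m0 mz mmin]] : exists m : {poly 'F_p}, [/\ m != 0, root (map_poly iF m) z
    & forall f, root (map_poly iF f) z -> m %| f].
  (* Coefficient tuples turn the existence of an annihilating polynomial into a boolean, so that a
     shortest one can be taken. *)
  pose Q n := [exists t : n.-tuple 'F_p,
     (Poly t != 0) && root (map_poly iF (Poly t)) z].
  have exQ : exists n, Q n.
    by exists (size Xq); apply/existsP; exists (in_tuple Xq); rewrite polyseqK Xq0.
  case: (ex_minnP exQ) => n /existsP[t /andP[t0 tz]] nmin.
  exists (Poly t); split=> // f fz.
  have [r0|r0] := eqVneq (f %% Poly t) 0; first exact/modp_eq0P.
  have /nmin : Q (size (f %% Poly t)).
    apply/existsP; exists (in_tuple (f %% Poly t)).
    rewrite polyseqK r0 /=; move: fz; rewrite {1}(divp_eq f (Poly t)).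
    by rewrite rmorphD rmorphM /= rootE !hornerE (rootP tz) mulr0 add0r.
  rewrite leqNgt (leq_trans _ (_ : size (Poly t) <= n)%N) ?ltn_modp //.
  by rewrite -{2}(size_tuple t) size_Poly.
have [eta etaP] : exists eta : K, root (map_poly iK m) eta.
  have : map_poly iK m %| map_poly iK Xq by rewrite dvdp_map mmin.
  rewrite /Xq rmorphB /= map_polyXn map_polyX finField_genPoly => dv.
  have := dvdp_prod_XsubC dv => -[msk eqp].
  have sm : (1 < size m)%N.
    rewrite ltnNge; apply/negP => /size1_polyC mC.
    by move: mz m0; rewrite mC map_polyC rootC /= fmorph_eq0 => /eqP->; rewrite polyC0 eqxx.
  move: (eqp_size eqp); rewrite size_map_poly size_prod_XsubC.
  case E: (mask _ _) eqp => [|eta s] eqp se; first by rewrite se in sm.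
  by exists eta; rewrite (eqp_root eqp) root_prod_XsubC inE eqxx.
have repr (x : F) : exists f : {poly 'F_p}, (map_poly iF f).[z] = x.
  have [->|/zgen[i ->]] := eqVneq x 0; first by exists 0; rewrite rmorph0 horner0.
  by exists 'X^i; rewrite map_polyXn hornerXn.
have [r rP] := fin_all_exists repr.
(* Hence the value at [eta] does not depend on the polynomial [r x] chosen to represent [x]. *)
have kill f : (map_poly iF f).[z] = 0 -> (map_poly iK f).[eta] = 0.
  move=> /eqP/mmin/dvdpP[g ->].
  by rewrite rmorphM /= hornerM (rootP etaP) mulr0.
pose phi x := (map_poly iK (r x)).[eta].
have phiE f x : (map_poly iF f).[z] = x -> phi x = (map_poly iK f).[eta].
  move=> fx; apply/eqP; rewrite -subr_eq0 -hornerN -hornerD -rmorphB /=.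
  by apply/eqP/kill; rewrite rmorphB /= !hornerE rP fx subrr.
have phiB : zmod_morphism phi.
  move=> x y; rewrite (phiE (r x - r y)) ?rmorphB /= ?hornerE ?rP //.
have phiM : monoid_morphism phi.
  split=> [|x y]; first by rewrite (phiE 1) rmorph1 hornerC.
  by rewrite (phiE (r x * r y)) ?rmorphM /= ?hornerM ?rP.
pose b1 := GRing.isZmodMorphism.Build F K phi phiB.
pose b2 := GRing.isMonoidMorphism.Build F K phi phiM.
pose phi' : {rmorphism F -> K} := HB.pack phi b1 b2.
by exists; exact: phi'.
Qed.

(** The product [P] over the Frobenius conjugates of a generator [z] has coefficients c with c^2 =
    c, that is 0 or 1. So [theta] fixes [P] and sends [z] to one of these conjugates, which
    determines [theta]. *)
Lemma finField_automorphism (h : nat) (F : finFieldType) (theta : {rmorphism F -> F}) :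
  #|F| = (2 ^ h)%N -> exists k, forall x, theta x = x ^+ (2 ^ k).
Proof.
move=> cF.
have cF2 : 2%N \in [pchar F] := card_finPcharP cF isT.
have [z [z0 zgen _]] := finField_generator F.
have h0 : (0 < h)%N by case: h cF => // cF; move: (finNzRing_gt1 F); rewrite cF.
pose P : {poly F} := \prod_(i < h) ('X - (z ^+ (2 ^ i))%:P).
have Pfr : map_poly (pFrobenius_aut cF2) P = P.
  rewrite /P rmorph_prod /=.
  case: h h0 cF @P => // n _ cF P.
  (* Squaring shifts the factors by one, and the last becomes the first because [z ^+ #|F| = z]. *)
  rewrite big_ord_recr [RHS]big_ord_recl /= mulrC; congr (_ * _).
    rewrite map_polyXsubC /= pFrobenius_autE -exprM -expnSr -cF expf_card.
    by rewrite expn0 expr1.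
  apply: eq_bigr => i _; rewrite map_polyXsubC /= pFrobenius_autE -exprM -expnSr.
  by rewrite /bump.
have Pth : map_poly theta P = P.
  apply/polyP => i; rewrite coef_map /=.
  have := congr1 (fun p : {poly F} => p`_i) Pfr; rewrite coef_map /= pFrobenius_autE.
  move/eqP; rewrite expr2 -subr_eq0 -[X in _ - X]mulr1 -mulrBr mulf_eq0 subr_eq0.
  by case/orP => /eqP ->; rewrite ?rmorph0 ?rmorph1.
have Pz : root P z.
  rewrite /P; case: h h0 {cF Pth Pfr} @P => // n _ P.
  by rewrite big_ord_recl rootM root_XsubC expr1 eqxx.
have : root P (theta z) by rewrite -Pth rootE horner_map (rootP Pz) rmorph0.
rewrite /P /root horner_prod => /prodf_eq0[k _].
rewrite !hornerE subr_eq0 => /eqP thz; exists k => x.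
have [->|/zgen[i ->]] := eqVneq x 0.
  by rewrite rmorph0 expr0n expn_eq0.
by rewrite rmorphXn /= thz -!exprM mulnC.
Qed.

(** For d = gcd(k, h) the power map fixes the subfield of order 2^d, whose nonzero elements are the
    powers of [z ^+ e] with e = (2^h - 1) / (2^d - 1). So [z ^+ e] must be 1, which forces 2^d - 1 =
    1. *)
Lemma frobenius_fixed_coprime (h k : nat) (F : finFieldType) :
  #|F| = (2 ^ h)%N -> (0 < h)%N ->
  (forall x : F, x ^+ (2 ^ k) = x -> x = 0 \/ x = 1) -> coprime k h.
Proof.
move=> cF h0 fixk.
have [z [z0 _ zord]] := finField_generator F.
set d := gcdn k h.
have d0 : (0 < d)%N by rewrite gcdn_gt0 h0 orbT.
have pd j : (d %| j)%N -> ((2 ^ d).-1 %| (2 ^ j).-1)%N.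
  by case/dvdnP => i ->; rewrite mulnC expnM [X in (_ %| X)%N]predn_exp dvdn_mulr.
have [e eE] := dvdnP (pd h (dvdn_gcdr k h)).
have pos j : (0 < 2 ^ j)%N by rewrite expn_gt0.
have fx : (z ^+ e) ^+ (2 ^ k) = z ^+ e.
  have [c cE] := dvdnP (pd k (dvdn_gcdl k h)).
  rewrite -(prednK (pos k)) cE exprS -exprM mulnCA -eE mulnC exprM.
  have -> : z ^+ (2 ^ h).-1 = 1.
    by apply: (mulfI z0); rewrite -exprS prednK // -cF expf_card mulr1.
  by rewrite expr1n mulr1.
case: (fixk _ fx) => [/eqP|]; first by rewrite expf_eq0 (negPf z0) andbF.
move/zord; rewrite cF eE => H.
have e0 : (0 < e)%N.
  rewrite lt0n; apply: contraTneq h0 => e0; move: eE; rewrite e0 mul0n.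
  by case: (h) => // n; rewrite expnS -(prednK (pos n)) mulnS.
move: H; rewrite -[X in (_ %| X)%N]muln1 dvdn_pmul2l // dvdn1 => /eqP.
move=> d1; rewrite /coprime -/d; move: d0 d1.
case: (d) => [//|[//|j]] _; rewrite !expnS -(prednK (pos j)) !mulnS.
by move=> ?.
Qed.

Lemma embedding_twist (h : nat) (F K : finFieldType) (theta : {rmorphism F -> F}) :
  #|F| = (2 ^ h)%N -> (0 < h)%N -> #|K| = (#|F| ^ 2)%N ->
  (forall x, theta x = x -> x = 0 \/ x = 1) ->
  exists (phi : {rmorphism F -> K}) (n : nat),
    gcdn n (2 * h) = 1%N /\ forall x, phi (theta x) = phi x ^+ (2 ^ n).
Proof.
move=> cF h0 cK fixt.
have [phi] := finField_embedding (isT : prime 2) cF cK.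
have [k kE] := finField_automorphism theta cF.
have cop : coprime k h.
  by apply: (frobenius_fixed_coprime cF) => // x; rewrite -kE; apply: fixt.
exists phi.
have [ok|ek] := boolP (odd k).
  exists k; split; last by move=> x; rewrite kE rmorphXn.
  by apply/eqP; rewrite -[_ == _]/(coprime _ _) coprimeMr cop coprimen2 ok.
(* An even [k] prime to [h] forces [h] odd; then [k + h] is odd, still prime to [h], and gives the
   same power map on [F]. *)
exists (k + h)%N; split; last first.
  by move=> x; rewrite kE expnD exprM -cF -!rmorphXn expf_card.
apply/eqP; rewrite -[_ == _]/(coprime _ _) coprimeMr coprimen2 oddD (negPf ek).
have -> : coprime (k + h) h by rewrite /coprime gcdnC gcdnDr gcdnC.
by rewrite -coprime2n (coprime_dvdl _ cop) // dvdn2.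
Qed.

(** * The Bruck-Bose plane of a semilinear map *)

Lemma vec3_eta (K : finFieldType) (w : 'rV[K]_3) :
  w = vec3 (w 0 0) (w 0 1) (w 0 ord_max).
Proof.
apply/rowP => i; rewrite mxE; case: i => -[|[|[|//]]] Hi /=;
  by congr (w _ _); apply/val_inj.
Qed.

Lemma vec3_lincomb (K : finFieldType) (a x y z x' y' z' : K) :
  a *: vec3 x y z + vec3 x' y' z' = vec3 (a * x + x') (a * y + y') (a * z + z').
Proof.
by apply/rowP => i; rewrite !mxE; case: i => -[|[|[|//]]] Hi.
Qed.

Lemma vec3Z (K : finFieldType) (a x y z : K) :
  a *: vec3 x y z = vec3 (a * x) (a * y) (a * z).
Proof.
by apply/rowP => i; rewrite !mxE; case: i => -[|[|[|//]]] Hi.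
Qed.

Lemma vec3_inj (K : finFieldType) (x y z x' y' z' : K) :
  vec3 x y z = vec3 x' y' z' -> [/\ x = x', y = y' & z = z'].
Proof.
move/rowP => e; have := e 0; have := e 1; have := e ord_max.
by rewrite !mxE.
Qed.

Lemma vec3_max (K : finFieldType) (x y z : K) : vec3 x y z 0 ord_max = z.
Proof. by rewrite mxE. Qed.

Definition line_inf (K : finFieldType) : {vspace 'rV[K]_3} :=
  (<[vec3 1%R 0%R 0%R]> + <[vec3 0%R 1%R 0%R]>)%VS.

Lemma mem_line_inf (K : finFieldType) (w : 'rV[K]_3) :
  (w \in line_inf K) = (w 0 ord_max == 0).
Proof.
apply/memv_addP/eqP => [[_ /vlineP[a ->] [_ /vlineP[b ->] ->]]|w0].
  by rewrite !mxE /= !mulr0 addr0.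
exists (w 0 0 *: vec3 1 0 0); first by rewrite memvZ ?memv_line.
exists (w 0 1 *: vec3 0 1 0); first by rewrite memvZ ?memv_line.
by rewrite [LHS]vec3_eta w0 [X in _ = _ + X]vec3Z vec3_lincomb !mulr0 !mulr1 !(addr0, add0r).
Qed.

Lemma dim_line_inf (K : finFieldType) : \dim (line_inf K) = 2%N.
Proof.
rewrite dimv_disjoint_sum ?dim_vline.
  have -> : vec3 1 0 0 != 0 :> 'rV[K]_3.
    by apply/eqP => /rowP/(_ 0)/eqP; rewrite !mxE oner_eq0.
  have -> // : vec3 0 1 0 != 0 :> 'rV[K]_3.
  by apply/eqP => /rowP/(_ 1)/eqP; rewrite !mxE oner_eq0.
apply/eqP; rewrite -subv0; apply/subvP => w.
rewrite memv_cap => /andP[/vlineP[a ->] /vlineP[b]].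
move=> e; have -> : a = 0 by move: e; rewrite !vec3Z => /vec3_inj[]; rewrite mulr1 mulr0.
by rewrite scale0r mem0v.
Qed.

(** Lets the isomorphism of planes be given by a relation, matching objects with their pullbacks,
    without a formula in either direction. *)
Lemma rel_bijection (A B : finType) (r : A -> B -> Prop) :
  (forall a, exists b, r a b) -> (forall b, exists a, r a b) ->
  (forall a b b', r a b -> r a b' -> b = b') ->
  (forall a a' b, r a b -> r a' b -> a = a') ->
  exists2 f : A -> B, bijective f & forall a, r a (f a).
Proof.
move=> /fin_all_exists[f rf] /fin_all_exists[g rg] fun_r inj_r.
exists f => //; exists g => [a|b]; first exact: inj_r (rg _) (rf a).
exact: fun_r (rf _) (rg b).
Qed.

Lemma dim_line_add (F : fieldType) (V : vectType F) (x : V) (X : {vspace V}) :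
  x \notin X -> \dim (<[x]> + X) = (\dim X).+1.
Proof.
move=> Xx; rewrite dimv_disjoint_sum ?dim_vline.
  by have -> : x != 0 by apply: contraNneq Xx => ->; rewrite mem0v.
apply/eqP; rewrite -subv0; apply/subvP => y; rewrite memv_cap => /andP[/vlineP[a ->]].
have [->|a0] := eqVneq a 0; first by rewrite scale0r !mem0v.
by move=> Xax; case/negP: Xx; rewrite -[x]scale1r -(mulVf a0) -scalerA memvZ.
Qed.

Lemma dim_flat (F : finFieldType) (n d : nat) (X : flat F n d) : \dim X = d.+1.
Proof. by case: X => /= X /eqP. Qed.

Lemma point_span (F : finFieldType) n (P : pg_point F n) w :
  w \in (P : {vspace _}) -> w != 0 -> P = <[w]>%VS :> {vspace _}.
Proof.
move=> Pw w0; apply/esym/eqP; rewrite eqEdim -memvE Pw dim_vline w0.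
by rewrite dim_flat.
Qed.

Lemma point_ex (F : finFieldType) n (P : pg_point F n) :
  exists2 w, w != 0 & P = <[w]>%VS :> {vspace _}.
Proof.
have P0 : vpick P != 0 by rewrite vpick0 -dimv_eq0 dim_flat.
by exists (vpick P) => //; apply: point_span (memv_pick P) P0.
Qed.

Lemma point_of_vector (F : finFieldType) n (w : 'rV[F]_n.+1) : w != 0 ->
  exists P : pg_point F n, P = <[w]>%VS :> {vspace _}.
Proof.
move=> w0; have dw : \dim <[w]> == 1%N by rewrite dim_vline w0.
by exists (Flat dw).
Qed.

Lemma capv_points (F : finFieldType) n (P Q : pg_point F n) : P != Q -> (P :&: Q = 0)%VS.
Proof.
move=> PQ; apply/eqP; rewrite -subv0; apply/subvP => w.
rewrite memv_cap memv0 => /andP[Pw Qw]; apply: contraNT PQ => w0.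
by apply/eqP/val_inj; rewrite /= (point_span Pw w0) (point_span Qw w0).
Qed.

(** Any [om] outside the image of [phi] is independent of 1, and then the q^2 pairs of coefficients
    exhaust [K] by counting. *)
Lemma quadratic_basis (F K : finFieldType) (phi : {rmorphism F -> K}) :
  #|K| = (#|F| ^ 2)%N -> exists om : K,
    (forall a b, phi a + phi b * om = 0 -> a = 0 /\ b = 0) /\
    (forall t, exists a b, t = phi a + phi b * om).
Proof.
move=> cardK.
have [om om_phi] : exists om, om \notin codom phi.
  apply/existsP; rewrite -negb_forall; apply/negP => /forallP all_phi.
  have : (#|K| <= #|F|)%N.
    rewrite -(card_codom (fmorph_inj phi)); apply: subset_leq_card.
    by apply/subsetP => x _; apply: all_phi.
  by rewrite cardK expnS expn1 leqNgt ltn_Pmulr ?finNzRing_gt1 // ltnW ?finNzRing_gt1.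
have free_om a b : phi a + phi b * om = 0 -> a = 0 /\ b = 0.
  have [-> /eqP|b0 e] := eqVneq b 0.
    by rewrite rmorph0 mul0r addr0 fmorph_eq0 => /eqP.
  case/negP: om_phi; suff -> : om = phi (- a / b) by apply: codom_f.
  rewrite fmorph_div rmorphN /= (addr0_eq e) mulrC mulKf //.
  by rewrite fmorph_eq0.
exists om; split=> // t.
pose c (ab : F * F) := phi ab.1 + phi ab.2 * om.
have c_inj : injective c.
  move=> [a b] [a' b'] e; have [] := free_om (a - a') (b - b').
    rewrite !rmorphB /= mulrBl addrACA -opprD; apply/eqP.
    by rewrite subr_eq0; apply/eqP.
  by move=> /eqP; rewrite subr_eq0 => /eqP -> /eqP; rewrite subr_eq0 => /eqP ->.
have cardFF : (#|K| <= #|{: F * F}|)%N by rewrite cardK card_prod expnS expn1.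
by have /codomP[[a b] ->] := inj_card_onto c_inj cardFF t; exists a, b.
Qed.

(** * Field reduction along an injective semilinear map *)

Section SemilinearModel.

Variables (F K : finFieldType) (phi : {rmorphism F -> K}) (Sigma : pg_solid F 4).
Variable Psi : 'rV[F]_5 -> 'rV[K]_3.
Hypothesis cardK : #|K| = (#|F| ^ 2)%N.
Hypothesis PsiD : {morph Psi : u v / u + v}.
Hypothesis PsiZ : forall a (u : 'rV[F]_5), Psi (a *: u) = phi a *: Psi u.
Hypothesis Psi_eq0 : forall u, Psi u = 0 -> u = 0.
Hypothesis Psi_inf : forall u, (u \in (Sigma : {vspace _})) = (Psi u \in line_inf K).
(** [Psi] cannot be onto, as there are q^5 vectors against q^6. Last coordinates 0 and 1 are enough
    to reach every vector of K^3 up to a scalar of [K]. *)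
Hypothesis Psi_onto : forall w : 'rV[K]_3, w 0 ord_max = 0 \/ w 0 ord_max = 1 ->
  exists u, Psi u = w.

Implicit Types L : {vspace 'rV[K]_3}.

Let Psi0 : Psi 0 = 0.
Proof. by rewrite -(scale0r 0) PsiZ rmorph0 scale0r. Qed.

Let PsiN u : Psi (- u) = - Psi u.
Proof. by rewrite -scaleN1r PsiZ rmorphN rmorph1 scaleN1r. Qed.

Let Psi_inj : injective Psi.
Proof.
move=> u v e; apply/eqP; rewrite -subr_eq0; apply/eqP/Psi_eq0.
by rewrite PsiD PsiN e subrr.
Qed.

(** The preimage of [L], built as the span of its vectors since [Psi] is only semilinear;
    [mem_pullback] shows that the span adds nothing. *)
Definition pullback L : {vspace 'rV[F]_5} :=
  <<[seq u <- enum 'rV[F]_5 | Psi u \in L]>>%VS.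

Lemma mem_pullback L u : (u \in pullback L) = (Psi u \in L).
Proof.
apply/idP/idP => [|Lu]; last by apply: memv_span; rewrite mem_filter Lu mem_enum.
rewrite /pullback; have : all (fun u => Psi u \in L) [seq u <- enum 'rV[F]_5 | Psi u \in L].
  exact: filter_all.
elim: [seq _ <- _ | _] u => [|v s IH] u /=.
  by rewrite span_nil memv0 => _ /eqP ->; rewrite Psi0 mem0v.
case/andP => Lv Ls; rewrite span_cons => /memv_addP[_ /vlineP[a ->] [x sx ->]].
by rewrite PsiD PsiZ memvD ?memvZ //; apply: IH.
Qed.

(** Every vector of [L] is a [K]-multiple of some [Psi u], so [L] is determined by the images it
    contains. *)
Lemma pullback_sub L L' : (pullback L <= pullback L')%VS = (L <= L')%VS.
Proof.
apply/subvP/subvP => sub w; last by rewrite !mem_pullback; apply: sub.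
move=> Lw; have [w0|w0] := eqVneq (w 0 ord_max) 0.
  by have [u uw] := Psi_onto (or_introl w0); rewrite -uw -mem_pullback sub // mem_pullback uw.
pose w1 := (w 0 ord_max)^-1 *: w.
have [|u uw] := Psi_onto (_ : w1 0 ord_max = 0 \/ w1 0 ord_max = 1).
  by right; rewrite mxE mulVf.
rewrite -[w]scale1r -(mulfV w0) -scalerA memvZ // -/w1 -uw -mem_pullback sub //.
by rewrite mem_pullback uw memvZ.
Qed.

Lemma pullback_inj : injective pullback.
Proof.
move=> L L' e; apply/eqP; rewrite eqEsubv -!pullback_sub e subvv //.
Qed.

Lemma pullback_inf : pullback (line_inf K) = Sigma.
Proof. by apply/vspaceP => u; rewrite mem_pullback Psi_inf. Qed.

Lemma pullback_cap L L' : (pullback (L :&: L') = pullback L :&: pullback L')%VS.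
Proof. by apply/vspaceP => u; rewrite mem_pullback !memv_cap !mem_pullback. Qed.

Lemma dim_pullback_inf L : (L <= line_inf K)%VS -> \dim (pullback L) = (2 * \dim L)%N.
Proof.
move=> Linf; have /eqP : #|pullback L| = #|L|.
  rewrite -(card_imset _ Psi_inj) /=; apply: eq_card => w.
  apply/imsetP/idP => [[u]|Lw]; first by rewrite mem_pullback => Lu ->.
  have := subvP Linf w Lw; rewrite mem_line_inf => /eqP w0.
  by have [u uw] := Psi_onto (or_introl w0); exists u; rewrite ?mem_pullback ?uw.
by rewrite !card_vspace cardK -expnM eqn_exp2l ?finNzRing_gt1 // => /eqP.
Qed.

(** Only the part at infinity doubles its dimension; an affine vector adds one dimension over either
    field. Thus affine points pull back to points and affine lines to planes. *)
Lemma dim_pullback_affine L w : w \in L -> w 0 ord_max = 1 ->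
  \dim L = (\dim (L :&: line_inf K)).+1 /\
  \dim (pullback L) = (2 * \dim (L :&: line_inf K)).+1.
Proof.
move=> Lw w1; have [u uw] := Psi_onto (or_intror w1).
have w_inf : w \notin line_inf K by rewrite mem_line_inf w1 oner_eq0.
have LE : L = (<[w]> + (L :&: line_inf K))%VS.
  apply/eqP; rewrite eqEsubv subv_add capvSl -memvE Lw !andbT; apply/subvP => x Lx.
  rewrite -(subrK (x 0 ord_max *: w) x) addrC memv_add ?memvZ ?memv_line //.
  by rewrite memv_cap memvB ?memvZ //= mem_line_inf !mxE w1 mulr1 subrr.
have pE : pullback L = (<[u]> + pullback (L :&: line_inf K))%VS.
  apply/eqP; rewrite eqEsubv subv_add -memvE mem_pullback uw Lw pullback_sub capvSl !andbT.
  apply/subvP => x; rewrite mem_pullback => Lx.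
  have Su : u \notin (Sigma : {vspace _}) by rewrite Psi_inf uw.
  have : x \in (<[u]> + Sigma)%VS.
    suff -> : (<[u]> + Sigma)%VS = fullv by rewrite memvf.
    apply/eqP; rewrite eqEdim subvf dim_line_add // dimvf /dim /= mul1n.
    by rewrite dim_flat.
  case/memv_addP => _ /vlineP[a ->] [s Ss xE].
  move: Lx; rewrite xE PsiD PsiZ uw => Lx.
  rewrite memv_add ?memvZ ?memv_line // mem_pullback memv_cap -Psi_inf Ss andbT.
  by rewrite -(addKr (phi a *: w) (Psi s)) memvD ?memvN ?memvZ.
split; first by rewrite {1}LE dim_line_add // memv_cap (negPf w_inf) andbF.
rewrite pE dim_line_add ?dim_pullback_inf ?capvSr //.
by rewrite mem_pullback uw memv_cap (negPf w_inf) andbF.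
Qed.

Lemma affine_representative L : ~~ (L <= line_inf K)%VS ->
  exists2 w, w \in L & w 0 ord_max = 1.
Proof.
case/subvPn => w Lw; rewrite mem_line_inf => w0.
by exists ((w 0 ord_max)^-1 *: w); rewrite ?memvZ // mxE mulVf.
Qed.

Lemma dim_pullback_point (P : pg_point K 2) : ~~ (P <= line_inf K)%VS ->
  \dim (pullback P) = 1%N.
Proof.
case/affine_representative => w Pw w1; have [] := dim_pullback_affine Pw w1.
by rewrite dim_flat => -[<-] ->.
Qed.

Lemma dim_pullback_line (L : pg_line K 2) : ~~ (L <= line_inf K)%VS ->
  \dim (pullback L) = 3%N /\ \dim (L :&: line_inf K) = 1%N.
Proof.
case/affine_representative => w Pw w1; have [] := dim_pullback_affine Pw w1.
by rewrite dim_flat => -[<-] ->.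
Qed.

(** * The spread of pulled-back points at infinity, and its regularity *)

Definition pullback_spread : {set pg_line F 4} :=
  [set l : pg_line F 4 | [exists P : pg_point K 2,
    (P <= line_inf K)%VS && ((l : {vspace _}) == pullback P)]].

Lemma pullback_spreadP (l : pg_line F 4) :
  reflect (exists2 P : pg_point K 2, (P <= line_inf K)%VS & l = pullback P :> {vspace _})
          (l \in pullback_spread).
Proof.
rewrite inE; apply: (iffP existsP) => [[P /andP[Pi /eqP e]]|[P Pi e]]; exists P => //.
by rewrite Pi e eqxx.
Qed.

Lemma pullback0 : pullback 0 = 0%VS.
Proof.
apply/eqP; rewrite -subv0; apply/subvP => u; rewrite mem_pullback !memv0.
by move=> /eqP/Psi_eq0 ->.
Qed.

(** One normalised vector for each point at infinity, indexed by a type with q^2 + 1 elements so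
    that the spread can be counted. *)
Definition inf_vector (o : option K) : 'rV[K]_3 :=
  if o is Some t then vec3 1 t 0 else vec3 0 1 0.

Lemma inf_vector_neq0 o : inf_vector o != 0.
Proof.
case: o => [t|] /=; apply/eqP => /rowP; first by move/(_ 0)/eqP; rewrite !mxE oner_eq0.
by move/(_ 1)/eqP; rewrite !mxE oner_eq0.
Qed.

Lemma inf_vector_inf o : (<[inf_vector o]> <= line_inf K)%VS.
Proof. by rewrite -memvE mem_line_inf; case: o => [t|]; rewrite vec3_max. Qed.

Lemma inf_vector_inj o o' : <[inf_vector o]>%VS = <[inf_vector o']>%VS -> o = o'.
Proof.
move=> e; have : inf_vector o \in <[inf_vector o']>%VS by rewrite -e memv_line.
case/vlineP => k; case: o o' {e} => [t|] [t'|] //=; rewrite vec3Z => /vec3_inj[].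
- by rewrite mulr1 => <-; rewrite mul1r => ->.
- by rewrite mulr0 => /eqP; rewrite oner_eq0.
- by rewrite mulr1 => <- /eqP; rewrite mul0r oner_eq0.
Qed.

Lemma inf_vector_ex w : w != 0 -> w \in line_inf K ->
  exists o, <[w]>%VS = <[inf_vector o]>%VS.
Proof.
move=> w0; rewrite mem_line_inf => /eqP wm.
suff [o [k e]] : exists o k, w = k *: inf_vector o.
  exists o; apply/eqP; rewrite eqEdim !dim_vline w0 inf_vector_neq0 leqnn andbT.
  by rewrite -memvE e memvZ ?memv_line.
move: w0; rewrite (vec3_eta w) wm.
have [-> w0|x0 _] := eqVneq (w 0 0) 0.
  by exists None, (w 0 1); rewrite vec3Z mulr0 mulr1.
by exists (Some ((w 0 0)^-1 * w 0 1)), (w 0 0); rewrite vec3Z mulr1 mulr0 mulVKf.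
Qed.

Lemma dim_pullback_inf_point (P : pg_point K 2) : (P <= line_inf K)%VS ->
  \dim (pullback P) = 2%N.
Proof. by move/dim_pullback_inf ->; rewrite dim_flat. Qed.

Lemma pullback_spread_line (P : pg_point K 2) : (P <= line_inf K)%VS ->
  exists2 l, l \in pullback_spread & l = pullback P :> {vspace _}.
Proof.
move=> Pinf; have dP : \dim (pullback P) == 2%N by rewrite dim_pullback_inf_point.
by exists (Flat dP) => //; apply/pullback_spreadP; exists P.
Qed.

Lemma pullback_is_spread : is_spread Sigma pullback_spread.
Proof.
split.
- by move=> l /pullback_spreadP[P Pi ->]; rewrite -pullback_inf pullback_sub.
- have dl o : \dim (pullback <[inf_vector o]>) == 2%N.
    by rewrite dim_pullback_inf ?inf_vector_inf // dim_vline inf_vector_neq0.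
  pose line o : pg_line F 4 := Flat (dl o).
  have line_inj : injective line.
    by move=> o o' /(congr1 val)/= /pullback_inj/inf_vector_inj.
  rewrite -cardK addn1 -card_option -(card_imset _ line_inj); apply: eq_card => l.
  apply/pullback_spreadP/imsetP => [[P Pi e]|[o _ ->]].
    have [w w0 Pw] := point_ex P.
    have [|o wo] := inf_vector_ex w0; first by rewrite memvE -Pw.
    by exists o => //; apply/val_inj; rewrite /= e Pw wo.
  have [P Po] := point_of_vector (inf_vector_neq0 o).
  by exists P; rewrite /= Po // inf_vector_inf.
- move=> l m /pullback_spreadP[P Pi lP] /pullback_spreadP[Q Qi mQ] lm.
  rewrite lP mQ -pullback_cap capv_points ?pullback0 //.
  by apply: contraNneq lm => PQ; apply/eqP/val_inj; rewrite /= lP mQ PQ.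
- move=> P PS; have [u u0 Pu] := point_ex P.
  have Pu0 : Psi u != 0 by apply: contraNneq u0 => /Psi_eq0 ->.
  have [Q Qu] := point_of_vector Pu0.
  have Qinf : (Q <= line_inf K)%VS by rewrite Qu -memvE -Psi_inf memvE -Pu.
  have [l Sl lQ] := pullback_spread_line Qinf.
  by exists l => //; rewrite lQ Pu -memvE mem_pullback Qu memv_line.
Qed.

Lemma pullback_is_regular : is_regular_spread Sigma pullback_spread.
Proof.
split; first exact: pullback_is_spread.
(* Three transversals of the regulus suffice: those through [lam *: w1] for [lam]
   equal to 1, [om] and [1 + om] force [l] to be the pullback of a point. *)
move=> l1 l2 l3 /pullback_spreadP[P1 i1 e1] /pullback_spreadP[P2 i2 e2].
move=> /pullback_spreadP[P3 i3 e3] l12 l13 l23.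
have PneqQ (P Q : pg_point K 2) (l m : pg_line F 4) :
    l != m -> l = pullback P :> {vspace _} -> m = pullback Q :> {vspace _} -> P != Q.
  by move=> lm lP mQ; apply: contraNneq lm => PQ; apply/eqP/val_inj; rewrite /= lP mQ PQ.
have n12 := PneqQ _ _ _ _ l12 e1 e2; have n13 := PneqQ _ _ _ _ l13 e1 e3.
have n23 := PneqQ _ _ _ _ l23 e2 e3.
have P12 : (P1 + P2)%VS = line_inf K.
  apply/eqP; rewrite eqEdim subv_add i1 i2 dim_line_inf.
  by rewrite dimv_disjoint_sum ?capv_points // !dim_flat.
have [w3 w30 E3] := point_ex P3.
(* With [w1] and [w2] the components of [w3], the three points are spanned by [w1], [w2] and
   [w1 + w2]. *)
have : w3 \in (P1 + P2)%VS by rewrite P12 (subvP i3) // E3 memv_line.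
case/memv_addP => w1 P1w1 [w2 P2w2 w12].
have w10 : w1 != 0.
  apply: contraNneq n23 => w10; rewrite w10 add0r in w12.
  by apply/eqP/val_inj; rewrite /= E3 w12; apply: point_span => //; rewrite -w12.
have w20 : w2 != 0.
  apply: contraNneq n13 => w20; rewrite w20 addr0 in w12.
  by apply/eqP/val_inj; rewrite /= E3 w12; apply: point_span => //; rewrite -w12.
have free12 x y : x *: w1 + y *: w2 = 0 -> x = 0 /\ y = 0.
  move=> e; have : x *: w1 \in (P1 :&: P2)%VS.
    by rewrite memv_cap memvZ //= -[x *: w1]opprK (addr0_eq e) memvN memvZ.
  rewrite capv_points // memv0 scaler_eq0 (negPf w10) orbF => /eqP x0.
  by move: e; rewrite x0 scale0r add0r => /eqP; rewrite scaler_eq0 (negPf w20) orbF => /eqP.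
have [om [om_free _]] := quadratic_basis phi cardK.
apply/subsetP => l; rewrite inE => /andP[lS /forallP opp].
(* The vectors mapped to [lam *: w1] and [lam *: w2] span over [F] a line of the opposite regulus:
   their sum is mapped into [P3]. Since [l] meets this line, it contains a vector with coefficients
   [a], [b] from [F]. *)
have transversal lam : lam != 0 -> exists a b v,
    [/\ v \in (l : {vspace _}), v != 0 & Psi v = lam *: (phi a *: w1 + phi b *: w2)].
  move=> lam0.
  have onto (P : pg_point K 2) w : (P <= line_inf K)%VS -> w \in (P : {vspace _}) ->
      exists v, Psi v = lam *: w.
    move=> Pi Pw; apply: Psi_onto; left; apply/eqP; rewrite -mem_line_inf.
    by rewrite memvZ // (subvP Pi).
  have [v1 v1E] := onto _ _ i1 P1w1; have [v2 v2E] := onto _ _ i2 P2w2.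
  have lin a b : Psi (a *: v1 + b *: v2) = lam *: (phi a *: w1 + phi b *: w2).
    by rewrite PsiD !PsiZ v1E v2E scalerDr !scalerA ![_ * lam]mulrC.
  have lin0 a b : a *: v1 + b *: v2 = 0 -> a = 0 /\ b = 0.
    move=> /(congr1 Psi)/eqP; rewrite lin Psi0 scaler_eq0 (negPf lam0) /=.
    by move=> /eqP/free12[/eqP]; rewrite fmorph_eq0 => /eqP -> /eqP; rewrite fmorph_eq0 => /eqP ->.
  have v10 : v1 != 0.
    apply/eqP => v10; have [] := lin0 1 0; last by move/eqP; rewrite oner_eq0.
    by rewrite v10 scaler0 scale0r addr0.
  have v12 : v2 \notin <[v1]>%VS.
    apply/negP => /vlineP[k v2k]; have [] := lin0 k (-1).
      by rewrite -v2k scaleN1r subrr.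
    by move=> _ /eqP; rewrite oppr_eq0 oner_eq0.
  have dm : \dim (<[v2]> + <[v1]>) == 2%N by rewrite dim_line_add // dim_vline v10.
  pose m : pg_line F 4 := Flat dm.
  have meet (l' : pg_line F 4) v : v != 0 -> v \in (m : {vspace _}) ->
      v \in (l' : {vspace _}) -> meets m l'.
    move=> v0 mv l'v; apply: contraNneq v0 => e.
    by rewrite -memv0 -e memv_cap mv.
  have mv1 : v1 \in (m : {vspace _}) by apply: subvP (addvSr _ _) _ (memv_line _).
  have mv2 : v2 \in (m : {vspace _}) by apply: subvP (addvSl _ _) _ (memv_line _).
  have : m \in opposite_regulus Sigma l1 l2 l3.
    rewrite inE; apply/and4P; split.
    - by rewrite subv_add -!memvE !Psi_inf v1E v2E !memvZ ?(subvP i2 _ P2w2) ?(subvP i1 _ P1w1).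
    - by apply: meet v10 mv1 _; rewrite e1 mem_pullback v1E memvZ.
    - apply: (meet _ v2) => //; last by rewrite e2 mem_pullback v2E memvZ.
      by apply: contraNneq v12 => ->; rewrite mem0v.
    - apply: (meet _ (v1 + v2)); first 1 last.
      + exact: memvD.
      + by rewrite e3 mem_pullback PsiD v1E v2E -scalerDr -w12 E3 memvZ ?memv_line.
      + apply/eqP => v0; have [] := lin0 1 1; first by rewrite !scale1r.
        by move/eqP; rewrite oner_eq0.
  move=> om_m; have := opp m; rewrite om_m /= => lm.
  have /memv_capP[lv mv] := memv_pick (l :&: m).
  have [_ /vlineP[b ->] [_ /vlineP[a ->] vE]] := memv_addP mv.
  exists a, b, (vpick (l :&: m)); rewrite vpick0; split=> //.
  by rewrite vE addrC lin.
have om0 : om != 0.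
  apply/eqP => om0; have [] := om_free 0 1; first by rewrite om0 mulr0 rmorph0 addr0.
  by move=> _ /eqP; rewrite oner_eq0.
have om1 : 1 + om != 0.
  apply/eqP => om1; have [] := om_free 1 1; first by rewrite rmorph1 mul1r.
  by move=> /eqP; rewrite oner_eq0.
have [a1 [b1 [v1 [lv1 v10 E1]]]] := transversal 1 (oner_neq0 _).
have [a2 [b2 [v2 [lv2 v20 E2]]]] := transversal om om0.
have [a3 [b3 [v3 [lv3 v30 E3']]]] := transversal (1 + om) om1.
rewrite scale1r in E1.
have coord12 x y x' y' : x *: w1 + y *: w2 = x' *: w1 + y' *: w2 -> x = x' /\ y = y'.
  move/eqP; rewrite -subr_eq0 opprD addrACA -!scalerBl => /eqP/free12[].
  by move=> /eqP; rewrite subr_eq0 => /eqP -> /eqP; rewrite subr_eq0 => /eqP ->.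
have v12 : v2 \notin <[v1]>%VS.
  apply/negP => /vlineP[c v2c]; case/eqP: v20; apply: Psi_eq0.
  move: E2; rewrite v2c PsiZ E1 !scalerDr !scalerA => /coord12[ea eb].
  have sol a b : phi c * phi a = om * phi b -> b = 0.
    move=> e; have [] := om_free (c * a) (- b); last by move=> _ /eqP; rewrite oppr_eq0 => /eqP.
    by rewrite rmorphM rmorphN /= e mulNr mulrC subrr.
  by rewrite ea eb (sol _ _ ea) (sol _ _ eb) rmorph0 mulr0 !scale0r addr0.
have lE : l = (<[v2]> + <[v1]>)%VS :> {vspace _}.
  apply/esym/eqP; rewrite eqEdim subv_add -!memvE lv1 lv2 /=.
  by rewrite dim_flat dim_line_add // dim_vline v10.
have : v3 \in (l : {vspace _}) by []; rewrite lE.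
case/memv_addP => _ /vlineP[t ->] [_ /vlineP[s ->] v3E].
move: E3'; rewrite v3E PsiD !PsiZ E1 E2 !scalerDr !scalerA addrACA -!scalerDl.
case/coord12 => ea eb.
(* Comparing the parts along 1 and [om] shows that (s a1, s b1) = (t a2, t b2), so [Psi v1] and
   [Psi v2] are proportional over [K]. *)
have sol a b c : phi t * (om * phi b) + phi s * phi a = (1 + om) * phi c ->
    c = s * a /\ c = t * b.
  move=> e; have [] := om_free (c - s * a) (c - t * b).
    rewrite !rmorphB !rmorphM /= mulrBl addrACA -opprD; apply/eqP.
    by rewrite subr_eq0 -[X in X + _]mul1r [phi c * om]mulrC -mulrDl -e addrC mulrCA [om * _]mulrC.
  by move=> /eqP; rewrite subr_eq0 => /eqP <- /eqP; rewrite subr_eq0 => /eqP <-.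
have [a3s a3t] := sol _ _ _ ea; have [b3s b3t] := sol _ _ _ eb.
have t0 : t != 0.
  apply: contraNneq v30 => t0; rewrite v3E t0 scale0r add0r.
  apply/eqP/Psi_eq0; rewrite PsiZ E1 scalerDr !scalerA -!rmorphM -a3s -b3s a3t b3t t0.
  by rewrite !mul0r rmorph0 !scale0r addr0.
have Psi21 : Psi v2 = (om * phi (s / t)) *: Psi v1.
  have k x y : s * x = t * y -> y = s / t * x.
    by move=> e; rewrite mulrAC e mulrAC mulfV // mul1r.
  rewrite E2 E1 -scalerA; congr (_ *: _); rewrite scalerDr !scalerA -!rmorphM.
  by rewrite -(k a1 a2) -?(k b1 b2) -?a3s -?b3s.
have Pv1 : Psi v1 != 0 by apply: contraNneq v10 => /Psi_eq0 ->.
have [Q Qv1] := point_of_vector Pv1.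
have Qi : (Q <= line_inf K)%VS by rewrite Qv1 -memvE -Psi_inf (subvP lS).
apply/pullback_spreadP; exists Q => //.
apply/eqP; rewrite eqEdim dim_pullback_inf_point // dim_flat leqnn andbT.
by rewrite lE subv_add -!memvE !mem_pullback Qv1 memv_line Psi21 memvZ ?memv_line.
Qed.

(** Each point or line of the Bruck-Bose plane is matched with the subspace of K^3 whose pullback it
    is. The last two conclusions locate the image of a set of affine points with points at infinity
    adjoined. *)
Lemma bruck_bose_isomorphism :
  exists (f : ipoint (bruck_bose Sigma pullback_spread) -> ipoint (PG2 K))
         (g : iline (bruck_bose Sigma pullback_spread) -> iline (PG2 K)),
  [/\ is_isomorphism f g,
      forall (P : affine_point Sigma) u, P = <[u]>%VS :> {vspace _} ->
        (f (inl P) : pg_point K 2) = <[Psi u]>%VS :> {vspace _}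
    & forall Q : pg_point K 2, (Q <= line_inf K)%VS ->
        exists l : spread_line pullback_spread, f (inr l) = Q].
Proof.
pose rp (x : bb_point Sigma pullback_spread) (Q : pg_point K 2) : Prop :=
  match x with
  | inl P => P = pullback Q :> {vspace _}
  | inr l => l = pullback Q :> {vspace _}
  end.
(* The line at infinity is a separate case: its pullback is all of [Sigma], not a plane. *)
pose rl (x : bb_line Sigma pullback_spread) (L : pg_line K 2) : Prop :=
  match x with
  | Some alpha => bb_plane alpha = pullback L :> {vspace _}
  | None => L = line_inf K :> {vspace _}
  end.
have infP (P : affine_point Sigma) (Q : pg_point K 2) :
    P = pullback Q :> {vspace _} -> ~~ (Q <= line_inf K)%VS.
  by move=> PQ; rewrite -pullback_sub pullback_inf -PQ; case: (P).
have affQ (P : affine_point Sigma) (Q : pg_point K 2) u :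
    P = <[u]>%VS :> {vspace _} -> Q = <[Psi u]>%VS :> {vspace _} ->
    P = pullback Q :> {vspace _}.
  move=> Pu Qu; apply/eqP; rewrite eqEdim Pu -memvE mem_pullback Qu memv_line /=.
  rewrite -Pu dim_flat -Qu dim_pullback_point // -pullback_sub pullback_inf.
  apply: contra (valP P) => /=; apply: subv_trans.
  by rewrite Pu -memvE mem_pullback Qu memv_line.
have inj_p x x' (Q : pg_point K 2) : rp x Q -> rp x' Q -> x = x'.
  case: x x' => [P|l] [P'|l'] /= e e'.
  - by congr inl; do 2!apply: val_inj; rewrite /= e e'.
  - by have := dim_flat P; rewrite e -e' dim_flat.
  - by have := dim_flat P'; rewrite e' -e dim_flat.
  - by congr inr; do 2!apply: val_inj; rewrite /= e e'.
have [f f_bij fP] : exists2 f, bijective f & forall x, rp x (f x).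
  apply: rel_bijection inj_p.
  - case=> [P|l].
      have [u u0 Pu] := point_ex P.
      have Pu0 : Psi u != 0 by apply: contraNneq u0 => /Psi_eq0 ->.
      have [Q Qu] := point_of_vector Pu0.
      by exists Q; apply: affQ Pu Qu.
    by have /pullback_spreadP[Q _ lQ] := valP l; exists Q.
  - move=> Q; have [Qi|Qi] := boolP (Q <= line_inf K)%VS.
      have [l Sl lQ] := pullback_spread_line Qi.
      by exists (inr (SpreadLine Sl)).
    have dQ : \dim (pullback Q) == 1%N by rewrite dim_pullback_point.
    have aQ : ~~ ((Flat dQ : pg_point F 4) <= Sigma)%VS.
      by rewrite /= -pullback_inf pullback_sub.
    by exists (inl (AffinePoint aQ)).
  - by case=> [P|l] Q Q' /= -> /pullback_inj/val_inj.
have inj_l x x' (L : pg_line K 2) : rl x L -> rl x' L -> x = x'.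
  case: x x' => [a|] [a'|] //= e e'.
  - by congr Some; do 2!apply: val_inj; rewrite /= e e'.
  - by have := dim_flat a; rewrite e e' pullback_inf dim_flat.
  - by have := dim_flat a'; rewrite e' e pullback_inf dim_flat.
have [g g_bij gP] : exists2 g, bijective g & forall x, rl x (g x).
  apply: rel_bijection inj_l.
  - case=> [a|]; last first.
      have di : \dim (line_inf K) == 2%N by rewrite dim_line_inf.
      by exists (Flat di).
    have /andP[aS /existsP[l /andP[/pullback_spreadP[P Pi lP] la]]] := valP a.
    (* The plane is spanned by an affine vector [u] and its spread line, so the matching [K]-line
       joins [Psi u] to the point [P] behind that spread line. *)
    have [u au Su] := subvPn aS.
    have Pu : Psi u \notin (P : {vspace _}).
      by apply: contra Su; rewrite Psi_inf; apply: (subvP Pi).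
    have dL : \dim (<[Psi u]> + P) == 2%N by rewrite dim_line_add // dim_flat.
    exists (Flat dL) => /=.
    have Li : ~~ ((Flat dL : pg_line K 2) <= line_inf K)%VS.
      rewrite /= -pullback_sub pullback_inf; apply: contra Su => /subvP; apply.
      by rewrite mem_pullback (subvP (addvSl _ _) _ (memv_line _)).
    have aE : bb_plane a = (<[u]> + l)%VS :> {vspace _}.
      apply/esym/eqP; rewrite eqEdim subv_add -memvE au la dim_line_add ?dim_flat //.
      by rewrite lP mem_pullback.
    apply/eqP; rewrite eqEdim (dim_pullback_line Li).1 dim_flat leqnn andbT.
    rewrite aE subv_add -memvE mem_pullback /= lP pullback_sub addvSr andbT.
    exact: subvP (addvSl _ _) _ (memv_line _).
  - move=> L; have [Li|Li] := boolP (L <= line_inf K)%VS.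
      exists None => /=; apply/eqP; rewrite eqEdim Li dim_line_inf dim_flat //.
    have [dp dc] := dim_pullback_line Li.
    have dp' : \dim (pullback L) == 3%N by rewrite dp.
    have dc' : \dim (L :&: line_inf K) == 1%N by rewrite dc.
    have ci : ((Flat dc' : pg_point K 2) <= line_inf K)%VS by apply: capvSr.
    have [l Sl lc] := pullback_spread_line ci.
    have bL : ~~ ((Flat dp' : pg_plane F 4) <= Sigma)%VS &&
        [exists l in pullback_spread, (l <= (Flat dp' : pg_plane F 4))%VS].
      rewrite /= -pullback_inf pullback_sub Li /=; apply/existsP; exists l.
      by rewrite Sl lc /= pullback_sub capvSl.
    by exists (Some (BBAffineLine bL)).
  - case=> [a|] L L' /=; first by move=> -> /pullback_inj/val_inj.
    by move=> e e'; apply/val_inj; rewrite /= e e'.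
exists f, g; split.
- split=> // x a; have := fP x; have := gP a; rewrite /=.
  case: x a => [P|l] [a|] /= ga fx.
  + by rewrite ga fx pullback_sub.
  + by rewrite ga; apply: negbTE; apply: infP fx.
  + by rewrite ga fx pullback_sub.
  + have /pullback_spreadP[Q Qi lQ] := valP l.
    by rewrite ga; move: fx; rewrite lQ => /pullback_inj <-.
- move=> P u Pu.
  have u0 : u != 0.
    by apply: contra_eq_neq (dim_flat P) => u0; rewrite Pu u0 dim_vline eqxx.
  have Pu0 : Psi u != 0 by apply: contraNneq u0 => /Psi_eq0 ->.
  have [Q Qu] := point_of_vector Pu0.
  by have := fP (inl P); rewrite /= (affQ _ _ _ Pu Qu) Qu => /pullback_inj.
- move=> Q Qi; have [l Sl lQ] := pullback_spread_line Qi.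
  exists (SpreadLine Sl); have := fP (inr (SpreadLine Sl)); rewrite /= lQ.
  by move/pullback_inj/val_inj.
Qed.

End SemilinearModel.

(** * The group of translations *)

Section MissingDirections.

Variables (F : finFieldType) (n : nat) (U : {vspace 'rV[F]_n}) (H : {set 'rV[F]_n}).
Hypotheses (dimU : \dim U = 2%N) (HU : forall h, h \in H -> h \in U).
Hypotheses (H0 : 0 \in H) (cardH : #|H| = #|F|) (F_gt2 : (2 < #|F|)%N).
Hypothesis H_cap : forall h a, h \in H -> h != 0 -> a *: h \in H -> a = 0 \/ a = 1.

(** The q - 1 nonzero vectors of [H] have distinct directions, so their multiples cover (q - 1)^2 of
    the q^2 - 1 nonzero vectors of [U]. The other 2(q - 1) are closed under nonzero scalars, hence
    form two punctured lines. *)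
Lemma missing_directions : exists p r : 'rV[F]_n,
  [/\ p \in U /\ r \in U, p != 0, r \notin <[p]>%VS,
      (forall a, a != 0 -> a *: p \notin H) /\ (forall a, a != 0 -> a *: r \notin H)
    & forall x, x \in U -> (forall a, a != 0 -> a *: x \notin H) ->
        x \in <[p]>%VS \/ x \in <[r]>%VS].
Proof.
pose Fx := [set a : F | a != 0].
have cardFx : #|Fx| = #|F|.-1.
  by rewrite -(cardsC1 (0 : F)); apply: eq_card => a; rewrite !inE.
pose cov := [set ah.1 *: ah.2 | ah in setX Fx (H :\ 0)].
have cardcov : #|cov| = (#|F|.-1 * #|F|.-1)%N.
  rewrite card_in_imset ?cardsX ?cardFx; first by rewrite -cardH (cardsD1 0 H) H0.
  move=> [a h] [b k]; rewrite !inE /= => /and3P[a0 h0 Hh] /and3P[b0 k0 Hk] e.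
  have hE : h = (a^-1 * b) *: k by rewrite -scalerA -e scalerA mulVf // scale1r.
  case: (H_cap Hk k0 (a := a^-1 * b)); first by rewrite -hE.
    by move=> ab; rewrite hE ab scale0r eqxx in h0.
  by move=> ab; rewrite hE ab scale1r; congr (_, _); rewrite -[a]mulr1 -ab mulVKf.
pose U' := [set x in U | x != 0].
have cardU' : #|U'| = (#|F| ^ 2).-1.
  rewrite -dimU -card_vspace (cardD1 0 U) mem0v /=; apply: eq_card => x.
  by rewrite !inE andbC.
have covU : cov \subset U'.
  apply/subsetP => _ /imsetP[[a h] /setXP[/= + /setD1P[h0 Hh]] ->]; rewrite !inE => a0.
  by rewrite memvZ ?HU // scaler_eq0 negb_or a0 h0.
pose M := U' :\: cov.
have cardM : #|M| = (#|F|.-1).*2.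
  rewrite cardsD (setIidPr covU) cardU' cardcov.
  case: #|F| F_gt2 => // m _; rewrite -mulnn mulSn mulnS addSn /=.
  by rewrite addnA addnK addnn.
have MP x : reflect [/\ x \in U, x != 0 & forall a, a != 0 -> a *: x \notin H] (x \in M).
  rewrite !inE andbC; apply: (iffP andP) => [[/andP[Ux x0] Cx]|[Ux x0 Hx]].
    split=> // a a0; apply: contra Cx => Hax; apply/imsetP; exists (a^-1, a *: x) => /=.
      by rewrite !inE /= invr_eq0 a0 Hax scaler_eq0 negb_or a0 x0.
    by rewrite scalerA mulVf // scale1r.
  rewrite Ux x0; split=> //; apply/imsetP => -[[a h]]; rewrite !inE /= => /and3P[a0 h0 Hh] xE.
  by have := Hx a^-1; rewrite invr_eq0 xE scalerA mulVf // scale1r Hh => /(_ a0).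
pose mult (x : 'rV[F]_n) := [set a *: x | a in Fx].
have card_mult x : x != 0 -> #|mult x| = #|F|.-1.
  move=> x0; rewrite card_imset ?cardFx // => a b /eqP.
  by rewrite -subr_eq0 -scalerBl scaler_eq0 (negPf x0) orbF subr_eq0 => /eqP.
have multM x : x \in M -> mult x \subset M.
  case/MP => Ux x0 Hx; apply/subsetP => _ /imsetP[a + ->]; rewrite inE => a0.
  apply/MP; split; rewrite ?memvZ // ?scaler_eq0 ?negb_or ?a0 // => b b0.
  by rewrite scalerA Hx // mulf_neq0.
have F1 : (0 < #|F|.-1)%N by case: #|F| F_gt2 => [|[|]].
have [p Mp] : exists p, p \in M by apply/set0Pn; rewrite -card_gt0 cardM double_gt0.
have [Up p0 Hp] := MP _ Mp.
have [r Mr rp] : exists2 r, r \in M & r \notin mult p.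
  apply/subsetPn/negP => /subset_leq_card; rewrite card_mult // cardM -addnn.
  by rewrite -[X in (_ <= X)%N]addn0 leq_add2l leqNgt F1.
have [Ur r0 Hr] := MP _ Mr.
have rp' : r \notin <[p]>%VS.
  apply: contra rp => /vlineP[a ra]; apply/imsetP; exists a => //.
  by rewrite inE; apply: contraNneq r0 => a0; rewrite ra a0 scale0r.
exists p, r; split=> // x Ux Hx.
have [->|x0] := eqVneq x 0; first by left; rewrite mem0v.
have : x \in M by apply/MP.
suff -> : M = mult p :|: mult r.
  by rewrite inE => /orP[] /imsetP[a _ ->]; [left|right]; rewrite memvZ ?memv_line.
apply/esym/eqP; rewrite eqEcard subUset !multM //= cardM cardsU !card_mult // -addnn.
suff -> : mult p :&: mult r = set0 by rewrite cards0 subn0.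
apply/setP => y; rewrite !inE; apply/negP => /andP[/imsetP[a _ ->] /imsetP[b + /esym e]].
rewrite inE => b0; case/negP: rp'; apply/vlineP; exists (b^-1 * a).
by rewrite -scalerA -e scalerA mulVf // scale1r.
Qed.

End MissingDirections.

Lemma oppv_pchar2 (F : fieldType) (V : lmodType F) :
  2%N \in [pchar F] -> forall x : V, - x = x.
Proof. by move=> c2 x; rewrite -scaleN1r (oppr_pchar2 c2) scale1r. Qed.

Section TranslationSet.

Variables (F : finFieldType) (n : nat).
Local Notation E := ('rV[F]_n).
(* [N x U] means that the affine plane [x + U] is a C-plane.  In characteristic 2
   a vector [y] belongs to it when [x + y \in U]. *)
Variables (W : {vspace E}) (D : {set E}) (N : E -> {vspace E} -> Prop).
Hypotheses (char2 : 2%N \in [pchar F]) (F_gt2 : (2 < #|F|)%N).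
Hypotheses (dimW : \dim W = 4%N) (DW : forall d, d \in D -> d \in W).
Hypotheses (D0 : 0 \in D) (cardD : #|D| = (#|F| ^ 2)%N).
(** [N_card] reflects (A1), [D_cap] the absence of three collinear points, [N_ex] and [N_uniq] (A2),
    [N_out] (A3), and [N_four] (A4). In [D_cap] the parameters 0 and 1 give [a] and [b]. *)
Hypothesis N_sub : forall x U, N x U -> (U <= W)%VS.
Hypothesis N_dim : forall x U, N x U -> \dim U = 2%N.
Hypothesis N_shift : forall x y U, N x U -> x + y \in U -> N y U.
Hypothesis N_card : forall x U, N x U -> #|[set y in D | x + y \in U]| = #|F|.
Hypothesis D_cap : forall a b k, a \in D -> b \in D -> a != b ->
  a + k *: (a + b) \in D -> k = 0 \/ k = 1.
Hypothesis N_ex : forall a b, a \in D -> b \in D -> a != b ->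
  exists2 U, N a U & a + b \in U.
Hypothesis N_uniq : forall a b U U', a \in D -> b \in D -> a != b ->
  N a U -> N a U' -> a + b \in U -> a + b \in U' -> U = U'.
Hypothesis N_out : forall x U U', x \in W -> x \notin D -> N x U -> N x U' -> U = U'.
Hypothesis N_four : forall a b d, a \in D -> b \in D -> d \in D -> a != b ->
  a + d \notin <[a + b]>%VS -> N a (<[a + b]> + <[a + d]>)%VS \/
  #|[set y in D | a + y \in (<[a + b]> + <[a + d]>)%VS]| = 4%N.

Let opp2 (x : E) : - x = x. Proof. exact: oppv_pchar2. Qed.
Let add2 (x : E) : x + x = 0. Proof. by rewrite -{2}[x]opp2 subrr. Qed.
Let addK2 (x y : E) : x + (x + y) = y. Proof. by rewrite addrA add2 add0r. Qed.
Let mid (x y z : E) : (x + y) + (y + z) = x + z.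
Proof. by rewrite -addrA addK2. Qed.
Let addI0 (x y : E) : x + y = 0 -> x = y.
Proof. by move=> e; rewrite -[x]addr0 -(add2 y) addrA e add0r. Qed.
Let addF2 (a : F) : a + a = 0. Proof. by rewrite -{2}[a](oppr_pchar2 char2) subrr. Qed.

Lemma exists_scalar : exists k : F, k != 0 /\ k != 1.
Proof.
have : ~~ ([set: F] \subset [set 0; 1]).
  apply: contraL F_gt2 => /subset_leq_card; rewrite cardsT cards2 -leqNgt.
  by move/leq_trans; apply; case: (_ != _).
by case/subsetPn => k _; rewrite !inE negb_or => /andP[k0 k1]; exists k.
Qed.

(** Both C-planes contain the line through [y] with direction [w]. By [D_cap] and q > 2 it has a
    point off [D], where [N_out] applies. *)
Lemma N_line x x' y w U U' : N x U -> N x' U' -> y \in W -> w != 0 ->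
  w \in U -> w \in U' -> x + y \in U -> x' + y \in U' -> U = U'.
Proof.
move=> NU NU' Wy w0 Uw U'w Uy U'y.
have [k ky] : exists k, y + k *: w \notin D.
  apply/existsP; rewrite -negb_forall; apply/negP => /forallP allD.
  have [k [k0 k1]] := exists_scalar.
  have yw : y + (y + w) = w by rewrite addK2.
  have Dy : y \in D by have := allD 0; rewrite scale0r addr0.
  have Dyw : y + w \in D by have := allD 1; rewrite scale1r.
  case: (D_cap Dy Dyw (k := k)); rewrite ?yw //.
  - by rewrite -subr_eq0 opp2 yw.
  - by move/eqP; rewrite (negPf k0).
  - by move/eqP; rewrite (negPf k1).
apply: (N_out (x := y + k *: w)) => //.
- by rewrite memvD // memvZ // (subvP (N_sub NU)).
- by apply: N_shift NU _; rewrite addrA memvD // memvZ.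
- by apply: N_shift NU' _; rewrite addrA memvD // memvZ.
Qed.

(* Otherwise [ab] and [de] meet in an affine point off [D], and the C-plane on
   that point contains all four of [a], [b], [d], [e]. *)
Lemma parallel_chords a b d e U k m :
  a \in D -> b \in D -> d \in D -> e \in D -> a != b -> e != d -> e != a -> e != b ->
  N a U -> a + b \in U -> a + d \notin U ->
  a + e = k *: (a + b) + m *: (a + d) -> m = 1.
Proof.
move=> Da Db Dd De ab; rewrite eq_sym => de ea eb NU Uab Uad aeE.
apply/eqP; rewrite -subr_eq0 (oppr_pchar2 char2); apply/negPn/negP => m1.
(* [d + e] has coefficient [m + 1] on [a + d]. Scaling it by [t] cancels [a + d] and leads from [d]
   to the intersection [X], at parameter [t] on [de] and [t * k] on [ab]. *)
pose t := (m + 1)^-1.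
have tm : t * (m + 1) = 1 by rewrite mulVf.
pose X := a + (t * k) *: (a + b).
have deE : d + e = k *: (a + b) + (m + 1) *: (a + d).
  by rewrite -(mid d a e) aeE addrC -addrA scalerDl scale1r [d + a]addrC.
have XE : X = d + t *: (d + e).
  rewrite deE scalerDr !scalerA tm scale1r /X addrCA [d + (a + d)]addrCA add2 addr0.
  by rewrite addrC.
have XD : X \notin D.
  apply/negP => DX.
  have t1 : t = 1.
    have : d + t *: (d + e) \in D by rewrite -XE.
    case/(D_cap Dd De de) => // t0.
    by move: tm; rewrite t0 mul0r => /esym/eqP; rewrite oner_eq0.
  have Xe : X = e by rewrite XE t1 scale1r addK2.
  case: (D_cap Da Db ab DX) => tk; move: Xe; rewrite /X tk.
    by rewrite scale0r addr0 => ae; rewrite ae eqxx in ea.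
  by rewrite scale1r addK2 => be; rewrite be eqxx in eb.
have WX : X \in W := memvD (DW Da) (memvZ _ (subvP (N_sub NU) _ Uab)).
have UX : a + X \in U by rewrite /X addK2 memvZ.
have NUX := N_shift NU UX.
have [U' NU' U'de] := N_ex Dd De de.
have U'X : d + X \in U' by rewrite XE addK2 memvZ.
have NU'X := N_shift NU' U'X.
have UU' := N_out WX XD NUX NU'X.
by case/negP: Uad; rewrite -(mid a X d) memvD // UU' addrC.
Qed.

(** For the fourth point [e] of the plane, [parallel_chords] makes one coefficient of [a + e] equal
    to 1; exchanging [b] and [d] does the same for the other. *)
Lemma sum3_off_plane a b d U : a \in D -> b \in D -> d \in D -> a != b ->
  N a U -> a + b \in U -> a + d \notin U -> a + b + d \in D.
Proof.
move=> Da Db Dd ab NU Uab Uad.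
have ad : a != d by apply: contraNneq Uad => ->; rewrite add2 mem0v.
have adab : a + d \notin <[a + b]>%VS.
  by apply: contra Uad => /vlineP[k ->]; rewrite memvZ.
set V := (<[a + b]> + <[a + d]>)%VS.
have Vab : a + b \in V by apply: subvP (addvSl _ _) _ (memv_line _).
have Vad : a + d \in V by apply: subvP (addvSr _ _) _ (memv_line _).
case: (N_four Da Db Dd ab adab) => [NV|cV].
  by case/negP: Uad; rewrite (N_uniq Da Db ab NU NV Uab Vab).
have [e] : exists e, e \in [set y in D | a + y \in V] :\: [set a; b; d].
  apply/set0Pn; rewrite -card_gt0 cardsD cV subn_gt0.
  apply: leq_ltn_trans (subset_leq_card (subsetIr _ _)) _.
  rewrite (leq_ltn_trans (leq_card_setU _ _)) // cards1 cards2.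
  by case: (_ != _).
rewrite !inE !negb_or -!andbA => /and5P[ea eb ed De Ve].
case/memv_addP: Ve => _ /vlineP[k ->] [_ /vlineP[m ->] aeE].
have m1 := parallel_chords Da Db Dd De ab ed ea eb NU Uab Uad aeE.
have [U' NU' U'ad] := N_ex Da Dd ad.
have U'ab : a + b \notin U'.
  apply: contra Uad => U'ab; rewrite (N_uniq Da Db ab NU NU' Uab U'ab) //.
rewrite [RHS]addrC in aeE.
have k1 := parallel_chords Da Dd Db De ad eb ea ed NU' U'ad U'ab aeE.
suff -> : a + b + d = e by [].
by rewrite -[RHS](addK2 a) aeE m1 k1 !scale1r [RHS]addrA addK2 addrC.
Qed.

Lemma D_off_plane a U : N a U -> exists2 e, e \in D & a + e \notin U.
Proof.
move=> NU; have : ~~ (D \subset [set y in D | a + y \in U]).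
  apply/negP => /subset_leq_card; rewrite (N_card NU) cardD leqNgt.
  by rewrite -{1}[#|F|]expn1 ltn_exp2l // ltnW.
by case/subsetPn => e De; rewrite inE De; exists e.
Qed.

(** If the three points share a C-plane, take [e] in [D] off it: f = a + b + e is in [D], and a + b
    + d = d + e + f. If [d], [e], f shared a C-plane too, it would have the direction [a + b] and
    the point [d] in common with the first, hence equal it and contain [e]. *)
Lemma sum3 a b d : a \in D -> b \in D -> d \in D -> a != b -> a + b + d \in D.
Proof.
move=> Da Db Dd ab; have [U NU Uab] := N_ex Da Db ab.
have [Uad|] := boolP (a + d \in U); last exact: sum3_off_plane NU Uab.
have [e De Uae] := D_off_plane NU.
have Df := sum3_off_plane Da Db De ab NU Uab Uae.
have de : d != e by apply: contraNneq Uae => <-.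
have [U' NU' U'de] := N_ex Dd De de.
have [U'df|U'df] := boolP (d + (a + b + e) \in U'); last first.
  suff -> : a + b + d = d + e + (a + b + e) by apply: sum3_off_plane NU' U'de U'df.
  by rewrite [a + b + e]addrC mid [RHS]addrC.
have U'ab : a + b \in U'.
  have -> : a + b = (d + e) + (d + (a + b + e)); last exact: memvD.
  by rewrite [d + e]addrC mid [a + b + e]addrC addK2.
have ab0 : a + b != 0 by apply: contraNneq ab => /addI0 ->.
have UU' : U = U'.
  by apply: (N_line NU NU' (DW Dd) ab0) => //; rewrite add2 mem0v.
by case/negP: Uae; rewrite -(mid a d e) memvD // UU'.
Qed.

Lemma D_add a b : a \in D -> b \in D -> a + b \in D.
Proof.
move=> Da Db; have [->|a0] := eqVneq a 0; first by rewrite add0r.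
by rewrite -[a]add0r; apply: sum3 => //; rewrite eq_sym.
Qed.

(** * C-planes through the origin and the projections between them *)

Lemma N0_ex d : d \in D -> d != 0 -> exists2 U, N 0 U & d \in U.
Proof.
move=> Dd d0; have [|U NU Ud] := N_ex D0 Dd; first by rewrite eq_sym.
by exists U => //; rewrite add0r in Ud.
Qed.

Lemma N0_cap U U' : N 0 U -> N 0 U' -> U != U' -> (U :&: U' = 0)%VS.
Proof.
move=> NU NU'; apply: contraNeq; rewrite -subv0 => /subvPn[w].
rewrite memv_cap memv0 => /andP[Uw U'w] w0; apply/eqP.
by apply: (N_line NU NU' (mem0v _) w0) => //; rewrite add0r mem0v.
Qed.

Lemma N0_disj U U' x : N 0 U -> N 0 U' -> U != U' -> x \in U -> x \in U' -> x = 0.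
Proof.
move=> NU NU' UU' Ux U'x; apply/eqP; rewrite -memv0 -(N0_cap NU NU' UU') memv_cap.
by rewrite Ux.
Qed.

Lemma N0_add U U' : N 0 U -> N 0 U' -> U != U' -> (U + U')%VS = W.
Proof.
move=> NU NU' UU'; apply/eqP; rewrite eqEdim subv_add (N_sub NU) (N_sub NU') dimW.
by rewrite dimv_disjoint_sum ?N0_cap // (N_dim NU) (N_dim NU').
Qed.

Lemma N0_card U : N 0 U -> #|[set y in D | y \in U]| = #|F|.
Proof.
move=> NU; rewrite -(N_card NU); apply: eq_card => y; by rewrite !inE add0r.
Qed.

Lemma D_cap0 h k : h \in D -> h != 0 -> k *: h \in D -> k = 0 \/ k = 1.
Proof.
move=> Dh h0 Dkh; apply: (D_cap D0 Dh); first by rewrite eq_sym.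
by rewrite !add0r.
Qed.

(** [A] and [B] meet in 0, so the q * q sums of their points of [D] are distinct and fill [D]. This
    is why the projections preserve [D]. *)
Lemma D_split A B d : N 0 A -> N 0 B -> A != B -> d \in D ->
  exists a b, [/\ a \in D, a \in A, b \in D, b \in B & d = a + b].
Proof.
move=> NA NB AB Dd.
pose HA := [set y in D | y \in A]; pose HB := [set y in D | y \in B].
suff : d \in [set ab.1 + ab.2 | ab in setX HA HB].
  case/imsetP => -[a b]; rewrite !inE /= => /andP[/andP[Da Aa] /andP[Db Bb]] ->.
  by exists a, b.
rewrite (_ : [set _ | _ in _] = D) //; apply/eqP; rewrite eqEcard; apply/andP; split.
  apply/subsetP => _ /imsetP[[a b] + ->]; rewrite !inE /=.
  by move=> /andP[/andP[Da Aa] /andP[Db Bb]]; apply: D_add.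
rewrite card_in_imset ?cardsX ?N0_card ?cardD ?mulnn //.
move=> [a b] [a' b']; rewrite !inE /=.
move=> /andP[/andP[Da Aa] /andP[Db Bb]] /andP[/andP[Da' Aa'] /andP[Db' Bb']] e.
have e' : a + a' = b + b'.
  by apply: addI0; rewrite addrACA e add2.
have aa : a + a' = 0.
  by apply: (N0_disj NA NB AB); [|rewrite e']; apply: memvD.
by move: (e'); rewrite aa => /esym/addI0 ->; rewrite (addI0 aa).
Qed.

Lemma proj_char B X x y : N 0 B -> N 0 X -> B != X -> y \in B -> x + y \in X ->
  daddv_pi B X x = y.
Proof.
move=> NB NX BX By Xxy; have BX0 := N0_cap NB NX BX.
have piX z : z \in X -> daddv_pi B X z = 0.
  move=> Xz; have XB0 : (X :&: B = 0)%VS by rewrite capvC.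
  have := daddv_pi_add XB0 (subvP (addvSl X B) _ Xz).
  by rewrite daddv_pi_id // => /eqP; rewrite -subr_eq0 opp2 addrC addK2 => /eqP.
by rewrite -(addK2 y x) linearD /= daddv_pi_id // [y + x]addrC piX // addr0.
Qed.

Lemma proj_mem B X x : N 0 B -> N 0 X -> B != X -> x \in W ->
  x + daddv_pi B X x \in X.
Proof.
move=> NB NX BX; rewrite -(N0_add NB NX BX) => /memv_addP[b Bb [c Xc ->]].
by rewrite (@proj_char _ _ _ b) // addrAC add2 add0r.
Qed.

Lemma proj_D B X x : N 0 B -> N 0 X -> B != X -> x \in D -> daddv_pi B X x \in D.
Proof.
move=> NB NX BX Dx; have [b [c [Db Bb Dc Xc ->]]] := D_split NB NX BX Dx.
by rewrite (@proj_char _ _ _ b) // addrAC add2 add0r.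
Qed.

Lemma projK A B X x : N 0 A -> N 0 B -> N 0 X -> A != X -> B != X -> x \in A ->
  daddv_pi A X (daddv_pi B X x) = x.
Proof.
move=> NA NB NX AX BX Ax; apply: proj_char => //.
by rewrite addrC proj_mem // (subvP (N_sub NA)).
Qed.

Lemma free_pair (p r : E) a b : p != 0 -> r \notin <[p]>%VS ->
  a *: p + b *: r = 0 -> a = 0 /\ b = 0.
Proof.
move=> p0 rp; have [-> /eqP|b0 e] := eqVneq b 0.
  by rewrite scale0r addr0 scaler_eq0 (negPf p0) orbF => /eqP.
case/negP: rp; apply/vlineP; exists (b^-1 * a).
by rewrite -scalerA (addI0 e) scalerA mulVf // scale1r.
Qed.

(** The composite of the two projections has an inverse of the same kind, which also preserves [D];
    a multiple landing in [D] would therefore come from one. *)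
Lemma missing_map A B U V x :
  N 0 A -> N 0 B -> N 0 U -> N 0 V -> A != U -> A != V -> B != U -> B != V ->
  x \in A -> (forall a, a != 0 -> a *: x \notin D) ->
  forall a, a != 0 -> a *: daddv_pi A V (daddv_pi B U x) \notin D.
Proof.
move=> NA NB NU NV AU AV BU BV Ax Hx a a0; apply: contra (Hx a a0) => Dx.
have := proj_D NA NU AU (proj_D NB NV BV Dx).
by rewrite !linearZ /= (@projK B A V) ?memv_pi // (@projK A B U).
Qed.

Section Diagonal.

Variables (U0 U1 Us : {vspace E}) (p r : E).
Hypotheses (N0 : N 0 U0) (N1 : N 0 U1) (Ns : N 0 Us).
Hypotheses (U01 : U0 != U1) (U0s : U0 != Us) (U1s : U1 != Us).
Hypotheses (U0p : p \in U0) (U0r : r \in U0) (p0 : p != 0) (rp : r \notin <[p]>%VS).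
Hypothesis Hp : forall a, a != 0 -> a *: p \notin D.
Hypothesis Hr : forall a, a != 0 -> a *: r \notin D.
Hypothesis missing : forall x, x \in U0 -> (forall a, a != 0 -> a *: x \notin D) ->
  x \in <[p]>%VS \/ x \in <[r]>%VS.
Hypothesis Dpr : p + r \in D.

(* The transition map [tau] from [U1] along [U] and back along [Us] preserves
   [D] in [U0] and sends [p + r] to the given point.  It permutes the two
   missing directions; if it swapped them, its square would be a scalar
   preserving [D], hence 1, and [tau] would have a fixed vector. *)
Lemma diagonal_mul a b a' b' : a *: p + b *: r \in D -> a' *: p + b' *: r \in D ->
  (a * a') *: p + (b * b') *: r \in D.
Proof.
have De := Dpr; set h := a *: p + b *: r; set e := p + r in De * => Dh Dh'.
have U0h : h \in U0 by rewrite memvD ?memvZ.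
have U0e : e \in U0 by rewrite memvD.
have e0 : e != 0.
  by apply: contraNneq rp => /addI0 ->; rewrite memv_line.
(* The cases h = 0 and h = e are immediate, and must be set aside for the C-planes below to be
   distinct. *)
have [h0|h0] := eqVneq h 0.
  by have [-> ->] := free_pair p0 rp h0; rewrite !mul0r !scale0r addr0.
have [he|he] := eqVneq h e.
  have : (a - 1) *: p + (b - 1) *: r = 0.
    by rewrite !scalerBl !scale1r addrACA -opprD -/h -/e he subrr.
  move/(free_pair p0 rp) => -[/eqP + /eqP]; rewrite !subr_eq0 => /eqP -> /eqP ->.
  by rewrite !mul1r.
pose f := daddv_pi U1 Us h.
have Df : f \in D by apply: proj_D.
have U1f : f \in U1 by apply: memv_pi.
have hK : daddv_pi U0 Us f = h by apply: projK.
have f0 : f != 0 by apply: contraNneq h0 => f0; rewrite -hK f0 linear0.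
have ef0 : e + f != 0.
  apply: contraNneq e0 => /addI0 ef; apply/eqP/(N0_disj N0 N1 U01) => //.
  by rewrite ef.
(* [U] is chosen so that projection along it carries [e] to [f]; projection along [Us] then carries
   [f] to [h]. *)
have [U NU Uef] := N0_ex (D_add De Df) ef0.
have U0U : U0 != U.
  apply: contraNneq f0 => UU; apply/eqP/(N0_disj N0 N1 U01) => //.
  by rewrite -(addK2 e f) memvD // UU.
have U1U : U1 != U.
  apply: contraNneq e0 => UU; apply/eqP/(N0_disj N0 N1 U01) => //.
  by rewrite -(addK2 f e) memvD // addrC UU.
have UsU : Us != U.
  apply: contraNneq he => UU; apply/eqP/addI0/(N0_disj N0 Ns U0s); first exact: memvD.
  rewrite -(mid h f e) memvD ?[f + e]addrC ?UU // -UU proj_mem //.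
  exact: DW.
pose tau (x : E) : E := daddv_pi U0 Us (daddv_pi U1 U x).
have tauD x : x \in D -> tau x \in D by move=> Dx; apply: proj_D => //; apply: proj_D.
have tauL c d x y : tau (c *: x + d *: y) = c *: tau x + d *: tau y.
  by rewrite /tau !linearD !linearZ.
have tau_e : tau e = h.
  by rewrite /tau (@proj_char U1 U e f).
(* For a fixed [x], the vector [x + y] lies in both [U] and [Us], so x = y lies in both [U0] and
   [U1]. *)
have tau_fix x : x \in U0 -> tau x = x -> x = 0.
  move=> U0x tx; pose y := daddv_pi U1 U x.
  have Wx : x \in W := subvP (N_sub N0) _ U0x.
  have U1y : y \in U1 := memv_pi _ _ _.
  have xy : x + y = 0.
    apply: (N0_disj NU Ns _); rewrite 1?eq_sym ?proj_mem //.
    by rewrite addrC -tx; apply: proj_mem => //; apply: (subvP (N_sub N1)).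
  by apply: (N0_disj N0 N1 U01) => //; rewrite (addI0 xy).
have tau_inj x : x \in U0 -> tau x = 0 -> x = 0.
  move=> U0x tx; rewrite -(@projK U0 U1 U x) //.
  by rewrite -(@projK U1 U0 Us (daddv_pi U1 U x)) ?memv_pi // -/(tau x) tx !linear0.
have tau_missing x : x \in U0 -> (forall c, c != 0 -> c *: x \notin D) ->
    exists c, tau x = c *: p \/ tau x = c *: r.
  move=> U0x Hx; have := missing_map N0 N1 NU Ns U0U U0s U1U U1s U0x Hx.
  move/(missing (memv_pi _ _ _)) => [] /vlineP[c cE]; exists c; [left|right]; exact: cE.
have hE : h = tau p + tau r by rewrite -tau_e -[e in LHS]/(p + r) /tau !linearD.
have [c tp] := tau_missing p U0p Hp; have [d tr] := tau_missing r U0r Hr.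
(* If [p] and [r] had the same image direction, [d *: p + c *: r] would be in the kernel of the
   injective [tau]. *)
have no_common x : x != 0 -> tau p = c *: x -> tau r = d *: x -> False.
  move=> x0 tpx trx; have : tau (d *: p + c *: r) = 0.
    by rewrite tauL tpx trx !scalerA mulrC -scalerDl addF2 scale0r.
  move/tau_inj; rewrite memvD ?memvZ // => /(_ isT)/(free_pair p0 rp)[_ c0].
  case/eqP: p0; apply: tau_inj => //; by rewrite tpx c0 scale0r.
have r0 : r != 0 by apply: contraNneq rp => ->; rewrite mem0v.
case: tp tr => tp [] tr.
- by case: (no_common p).
- have := tauD _ Dh'; rewrite tauL tp tr !scalerA.
  have : (a - c) *: p + (b - d) *: r = 0.
    by rewrite !scalerBl addrACA -opprD -tp -tr -hE subrr.
  move/(free_pair p0 rp) => -[/eqP + /eqP]; rewrite !subr_eq0 => /eqP -> /eqP ->.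
  by rewrite ![c * _]mulrC ![d * _]mulrC.
- have tt : tau (tau e) = (c * d) *: e.
    rewrite tau_e hE tp tr tauL tp tr !scalerA -[e]/(p + r) scalerDr.
    by rewrite [d * c]mulrC.
  have cd : c * d = 1.
    have : (c * d) *: e \in D by rewrite -tt (tauD (tau e)) // tauD.
    case/(D_cap0 De e0) => // cd0.
    have : tau e = 0.
      by apply: tau_inj; rewrite ?memv_pi // tt cd0 scale0r.
    by rewrite tau_e => /eqP; rewrite (negPf h0).
  have : tau (e + tau e) = e + tau e.
    by rewrite -[e + tau e]scale1r scalerDr tauL !scale1r tt cd scale1r addrC.
  move/tau_fix; rewrite memvD ?memv_pi // => /(_ isT)/addI0 et.
  by case/eqP: e0; apply: tau_fix.
- by case: (no_common r).
Qed.

End Diagonal.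

Lemma translation_set_structure : exists (theta : {rmorphism F -> F}) (p r p' r' : E),
  [/\ forall a b c d, a *: p + b *: r + (c *: p' + d *: r') = 0 ->
        [/\ a = 0, b = 0, c = 0 & d = 0],
      forall w, w \in W <-> exists a b c d, w = a *: p + b *: r + (c *: p' + d *: r'),
      forall d, d \in D <-> exists x y,
        d = theta x *: p + x *: r + (theta y *: p' + y *: r')
    & forall x, theta x = x -> x = 0 \/ x = 1].
Proof.
have F1 : (1 < #|F|)%N by apply: ltnW.
have nz (A : {set E}) : (1 < #|A|)%N -> exists2 x, x \in A & x != 0.
  move=> /card_gt1P[x [y [Ax Ay xy]]]; have [x0|] := eqVneq x 0; last by exists x.
  by exists y; rewrite // eq_sym -x0.
have [d0 Dd0 d00] : exists2 d, d \in D & d != 0.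
  by apply: nz; rewrite cardD (leq_trans F1) // -{1}[#|F|]expn1 leq_exp2l.
have [U0 N0 U0d0] := N0_ex Dd0 d00.
have [d1 Dd1 U0d1] := D_off_plane N0; rewrite add0r in U0d1.
have d10 : d1 != 0 by apply: contraNneq U0d1 => ->; rewrite mem0v.
have [U1 N1 U1d1] := N0_ex Dd1 d10.
have U01 : U0 != U1 by apply: contraNneq U0d1 => ->.
have d01 : d0 + d1 != 0 by apply: contraNneq U0d1 => /addI0 <-.
(* The sum [d0 + d1] is in neither [U0] nor [U1], which yields a third C-plane through 0 to project
   along. *)
have [Us Ns Usd] := N0_ex (D_add Dd0 Dd1) d01.
have U0s : U0 != Us.
  by apply: contraNneq U0d1 => U0s; rewrite -(addK2 d0 d1) memvD // U0s.
have U1s : U1 != Us.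
  apply: contraNneq d00 => U1s; apply/eqP/(N0_disj N0 N1 U01) => //.
  by rewrite -(addK2 d1 d0) memvD // addrC U1s.
pose H := [set y in D | y \in U0].
have cardH : #|H| = #|F| := N0_card N0.
have [||h a|p1 [r1 [[U0p1 U0r1] p10 rp1 [Hp1 Hr1] miss1]]] :=
  @missing_directions F n U0 H (N_dim N0) _ _ cardH F_gt2.
- by move=> h; rewrite inE => /andP[].
- by rewrite inE D0 mem0v.
- by rewrite !inE => /andP[Dh _] h0 /andP[Dah _]; apply: D_cap0 Dh h0 Dah.
have [h Hh h0] : exists2 h, h \in H & h != 0 by apply: nz; rewrite cardH.
have /andP[Dh U0h] : (h \in D) && (h \in U0) by rewrite inE in Hh.
have Hp1' a : a != 0 -> a *: p1 \notin D.
  by move=> a0; have := Hp1 a a0; rewrite inE memvZ // andbT.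
have Hr1' a : a != 0 -> a *: r1 \notin D.
  by move=> a0; have := Hr1 a a0; rewrite inE memvZ // andbT.
have U0E : U0 = (<[p1]> + <[r1]>)%VS.
  apply/esym/eqP; rewrite eqEdim subv_add -!memvE U0p1 U0r1 (N_dim N0) addvC /=.
  by rewrite dim_line_add // dim_vline p10.
have : h \in (<[p1]> + <[r1]>)%VS by rewrite -U0E.
case/memv_addP => _ /vlineP[al ->] [_ /vlineP[be ->] hE].
have al0 : al != 0.
  apply: contraTneq Dh => al0; rewrite hE al0 scale0r add0r Hr1' //.
  by apply: contraNneq h0 => be0; rewrite hE al0 be0 !scale0r addr0.
have be0 : be != 0.
  apply: contraTneq Dh => be0; rewrite hE be0 scale0r addr0 Hp1' //.
(* Rescaling the missing directions puts [p + r] in [D], so that theta will send 1 to 1. *)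
pose p := al *: p1; pose r := be *: r1.
have line_scale (x : E) a : a != 0 -> <[a *: x]>%VS = <[x]>%VS.
  move=> a0; apply/eqP; rewrite eqEsubv -!memvE memvZ ?memv_line //=.
  by apply/vlineP; exists a^-1; rewrite scalerA mulVf // scale1r.
have U0p : p \in U0 by rewrite memvZ.
have U0r : r \in U0 by rewrite memvZ.
have p0 : p != 0 by rewrite scaler_eq0 negb_or al0.
have rp : r \notin <[p]>%VS.
  rewrite line_scale //; apply: contra rp1 => /(memvZ be^-1).
  by rewrite scalerA mulVf // scale1r.
have Hp a : a != 0 -> a *: p \notin D by move=> a0; rewrite scalerA Hp1' // mulf_neq0.
have Hr a : a != 0 -> a *: r \notin D by move=> a0; rewrite scalerA Hr1' // mulf_neq0.
have miss x : x \in U0 -> (forall a, a != 0 -> a *: x \notin D) ->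
    x \in <[p]>%VS \/ x \in <[r]>%VS.
  move=> U0x Hx; rewrite !line_scale //; apply: miss1 => // a a0.
  by rewrite inE negb_and Hx.
have Dpr : p + r \in D by rewrite -hE.
have mulD := diagonal_mul N0 N1 Ns U01 U0s U1s U0p U0r p0 rp Hp Hr miss Dpr.
have free0 a b : a *: p + b *: r = 0 -> a = 0 /\ b = 0 by apply: free_pair.
have U0P x : x \in U0 -> exists a b, x = a *: p + b *: r.
  rewrite U0E => /memv_addP[_ /vlineP[a ->] [_ /vlineP[b ->] ->]].
  by exists (a / al), (b / be); rewrite !scalerA !mulfVK.
have inU0 a b : a *: p + b *: r \in U0 by rewrite memvD ?memvZ.
have coord0 a b a' b' : a *: p + b *: r = a' *: p + b' *: r -> a = a' /\ b = b'.
  move/eqP; rewrite -subr_eq0 opprD addrACA -!scalerBl => /eqP/free0[].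
  by move=> /eqP + /eqP; rewrite !subr_eq0 => /eqP -> /eqP ->.
have uniq_th a a' x : a *: p + x *: r \in D -> a' *: p + x *: r \in D -> a = a'.
  move=> Da Da'; have := D_add Da Da'; rewrite addrACA add2 addr0 -scalerDl.
  apply: contraTeq => aa; apply: Hp; apply: contraNneq aa => aa.
  by rewrite -subr_eq0 (oppr_pchar2 char2) aa.
(* By [uniq_th] the q points of [D] in [U0] have distinct coordinates along [r], which therefore
   exhaust [F]. *)
have ex_th x : exists a, a *: p + x *: r \in D.
  pose G := [set ax : F * F | ax.1 *: p + ax.2 *: r \in D].
  pose c (ax : F * F) : E := ax.1 *: p + ax.2 *: r.
  have c_inj : injective c by move=> [a b] [a' b'] /coord0[/= -> ->].
  have cardG : #|G| = #|F|.
    rewrite -cardH -(card_imset _ c_inj); apply: eq_card => y.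
    apply/imsetP/idP => [[ab Gab ->]|].
      by move: Gab; rewrite !inE => Dab; rewrite Dab inU0.
    rewrite inE => /andP[Dy /U0P[a [b yE]]].
    by exists (a, b); rewrite ?inE /= -?yE.
  have : x \in [set ax.2 | ax in G].
    suff -> : [set ax.2 | ax in G] = setT by rewrite inE.
    apply/eqP; rewrite eqEcard subsetT cardsT card_in_imset ?cardG ?leqnn //.
    move=> [a b] [a' b']; rewrite !inE /= => Da Da' bb; rewrite bb in Da *.
    by rewrite (uniq_th _ _ _ Da Da').
  by case/imsetP => -[a b]; rewrite inE /= => Dab ->; exists a.
have [th thD] := fin_all_exists ex_th.
have thE a x : a *: p + x *: r \in D -> th x = a by apply: uniq_th.
have thB : zmod_morphism th.
  move=> x y; apply: thE; rewrite !scalerBl addrACA -opprD [- (_ + _)]opp2.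
  exact: D_add.
have thM : monoid_morphism th.
  split=> [|x y]; apply: thE; first by rewrite !scale1r.
  exact: mulD.
pose b1 := GRing.isZmodMorphism.Build F F th thB.
pose b2 := GRing.isMonoidMorphism.Build F F th thM.
pose theta : {rmorphism F -> F} := HB.pack th b1 b2.
(* This projection matches the points of [D] in [U0] with those in [U1]; taking p' and r' as images
   of [p] and [r] gives both summands the same theta. *)
pose g := daddv_pi U1 Us.
have gL a b x y : g (a *: x + b *: y) = a *: g x + b *: g y.
  by rewrite linearD !linearZ.
have gK x : x \in U0 -> daddv_pi U0 Us (g x) = x by move=> U0x; apply: projK.
have gK' x : x \in U1 -> g (daddv_pi U0 Us x) = x by move=> U1x; apply: projK.
exists theta, p, r, (g p), (g r); split.
- move=> a b c d; rewrite -gL => /addI0 e.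
  have e1 : a *: p + b *: r = 0.
    by apply: (N0_disj N0 N1 U01) => //; rewrite e memv_pi.
  have [-> ->] := free0 _ _ e1; rewrite e1 in e.
  have [-> ->//] : c = 0 /\ d = 0.
  by apply: free0; rewrite -(gK (c *: p + d *: r)) // -e linear0.
- move=> w; split=> [|[a [b [c [d ->]]]]]; last first.
    rewrite -gL memvD // ?(subvP (N_sub N0) _ (inU0 _ _)) //.
    by rewrite (subvP (N_sub N1)) ?memv_pi.
  rewrite -(N0_add N0 N1 U01) => /memv_addP[u /U0P[a [b ->]] [v U1v ->]].
  have [c [d vE]] := U0P _ (memv_pi U0 Us v).
  by exists a, b, c, d; rewrite -gL -vE gK'.
- move=> d; split=> [/(D_split N0 N1 U01)[u [v [Du U0u Dv U1v ->]]]|[x [y ->]]].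
    have [a [x uE]] := U0P _ U0u.
    have [b [y vE]] := U0P _ (memv_pi U0 Us v).
    exists x, y; rewrite /= -gL (thE a) -?uE // (thE b) -?vE ?gK' //.
    exact: proj_D.
  by rewrite /= -gL D_add // proj_D.
(* A fixed point of theta puts [x *: (p + r)] in [D], on the line through 0 and [p + r]. *)
- move=> x /= thx; have := thD x; rewrite thx -scalerDr.
  apply: D_cap0 => //; apply: contraNneq rp => /addI0 ->; exact: memv_line.
Qed.

End TranslationSet.

(** * From planes to coordinates *)

Section AffineCoordinates.

Variables (F : finFieldType) (Sigma : pg_solid F 4).
Variables (C : {set affine_point Sigma}) (Cplanes : {set pg_plane F 4}).
Hypotheses (char2 : 2%N \in [pchar F]) (F_gt2 : (2 < #|F|)%N).
Hypothesis cardC : #|C| = (#|F| ^ 2)%N.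
Hypothesis A1 : forall alpha, alpha \in Cplanes ->
  is_arc #|F| alpha (plane_section C alpha).
Hypothesis A2 : forall P Q, P \in C -> Q \in C -> P != Q ->
  exists! alpha, [/\ alpha \in Cplanes, (P <= alpha)%VS & (Q <= alpha)%VS].
Hypothesis A3 : forall P : affine_point Sigma, P \notin C ->
  exists! alpha, alpha \in Cplanes /\ (P <= alpha)%VS.
Hypothesis A4 : forall alpha : pg_plane F 4, (3 <= #|plane_section C alpha|)%N ->
  #|plane_section C alpha| = 4%N \/ alpha \in Cplanes.

Let opp2 (x : 'rV[F]_5) : - x = x. Proof. exact: oppv_pchar2. Qed.
Let add2 (x : 'rV[F]_5) : x + x = 0. Proof. by rewrite -{2}[x]opp2 subrr. Qed.
Let addK2 (x y : 'rV[F]_5) : x + (x + y) = y. Proof. by rewrite addrA add2 add0r. Qed.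

(** Since [c0] and [Sigma] span the whole space, a point off [Sigma] has exactly one spanning vector
    in the coset of [c0]. *)
Lemma affine_vectors (c0 : 'rV[F]_5) : c0 \notin (Sigma : {vspace _}) ->
  exists2 vec : affine_point Sigma -> 'rV[F]_5, injective vec &
  [/\ forall P, vec P \in (Sigma : {vspace _}),
      forall P : affine_point Sigma, P = <[c0 + vec P]>%VS :> {vspace _}
    & forall v, v \in (Sigma : {vspace _}) -> exists P, vec P = v].
Proof.
move=> Sc0.
have Sc v : v \in (Sigma : {vspace _}) -> c0 + v \notin (Sigma : {vspace _}).
  by move=> Sv; apply: contra Sc0 => Scv; rewrite -(addrK v c0) memvB.
have fullE : (<[c0]> + Sigma)%VS = fullv.
  by apply/eqP; rewrite eqEdim subvf dim_line_add // dimvf /dim /= mul1n dim_flat.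
have rep (P : affine_point Sigma) : exists v,
    v \in (Sigma : {vspace _}) /\ P = <[c0 + v]>%VS :> {vspace _}.
  have [u u0 Pu] := point_ex P.
  have : u \in (<[c0]> + Sigma)%VS by rewrite fullE memvf.
  case/memv_addP => _ /vlineP[z ->] [s Ss uE].
  have Su : u \notin (Sigma : {vspace _}) by rewrite memvE -Pu; case: (P).
  have z0 : z != 0.
    by apply: contraNneq Su => z0; rewrite uE z0 scale0r add0r.
  exists (z^-1 *: s); rewrite memvZ //; split=> //.
  have cE : c0 + z^-1 *: s = z^-1 *: u by rewrite uE scalerDr scalerA mulVf // scale1r.
  apply: point_span; first by rewrite cE memvZ // Pu memv_line.
  by rewrite cE scaler_eq0 negb_or invr_eq0 z0.
have [vec vecP] := fin_all_exists rep.
have vec_uniq v v' : v \in (Sigma : {vspace _}) -> v' \in (Sigma : {vspace _}) ->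
    <[c0 + v]>%VS = <[c0 + v']>%VS -> v = v'.
  move=> Sv Sv' e; have /vlineP[k kE] : c0 + v \in <[c0 + v']>%VS by rewrite -e memv_line.
  have [k1|k1] := eqVneq k 1.
    by move: kE; rewrite k1 scale1r => /addrI.
  case/negP: Sc0; have /(memvZ (1 - k)^-1) : (1 - k) *: c0 \in (Sigma : {vspace _}).
    have -> : (1 - k) *: c0 = k *: v' - v; last by rewrite memvB ?memvZ.
    apply/eqP; rewrite scalerBl scale1r subr_eq addrAC eq_sym subr_eq addrC kE.
    by rewrite scalerDr addrC.
  by rewrite scalerA mulVf ?scale1r // subr_eq0 eq_sym.
exists vec; last split.
- move=> P Q e; do 2!apply: val_inj; rewrite /= (vecP P).2 (vecP Q).2 e //.
- by move=> P; case: (vecP P).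
- by move=> P; case: (vecP P).
- move=> v Sv; have cv0 : c0 + v != 0 by apply: contraNneq (Sc v Sv) => ->; rewrite mem0v.
  have [P Pv] := point_of_vector cv0.
  have aP : ~~ (P <= Sigma)%VS by rewrite Pv -memvE Sc.
  exists (AffinePoint aP); have [SP PE] := vecP (AffinePoint aP).
  by apply: vec_uniq => //; rewrite -PE -Pv.
Qed.

Lemma affine_coordinates : exists (theta : {rmorphism F -> F}) (c0 p r p' r' : 'rV[F]_5),
  [/\ c0 \notin (Sigma : {vspace _}),
      forall a b c d, a *: p + b *: r + (c *: p' + d *: r') = 0 ->
        [/\ a = 0, b = 0, c = 0 & d = 0],
      forall w, w \in (Sigma : {vspace _}) <->
        exists a b c d, w = a *: p + b *: r + (c *: p' + d *: r'),
      forall P : affine_point Sigma, P \in C <-> exists x y,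
        P = <[c0 + (theta x *: p + x *: r + (theta y *: p' + y *: r'))]>%VS :> {vspace _}
    & forall x, theta x = x -> x = 0 \/ x = 1].
Proof.
have [P0 CP0] : exists P0, P0 \in C.
  by apply/set0Pn; rewrite -card_gt0 cardC expn_gt0 ltnW // ltnW.
have [c0 c00 P0c] := point_ex P0.
have Sc0 : c0 \notin (Sigma : {vspace _}) by rewrite memvE -P0c; case: (P0).
have [vec vec_inj [vecS vecE vec_onto]] := affine_vectors Sc0.
have vecP (P : affine_point Sigma) (alpha : pg_plane F 4) :
    (P <= alpha)%VS = (c0 + vec P \in (alpha : {vspace _})).
  by rewrite vecE.
pose D := [set vec P | P in C].
(* A C-plane is encoded by one of its affine points and its line at infinity, which serves as its
   space of directions. *)
pose N (x : 'rV[F]_5) (U : {vspace 'rV[F]_5}) := x \in (Sigma : {vspace _}) /\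
  exists alpha : pg_plane F 4, [/\ alpha \in Cplanes, c0 + x \in (alpha : {vspace _})
    & U = (alpha :&: Sigma)%VS].
have DW d : d \in D -> d \in (Sigma : {vspace _}) by case/imsetP => P _ ->.
have vecD P : (vec P \in D) = (P \in C) by rewrite mem_imset.
have sec_mem (alpha : pg_plane F 4) (P : affine_point Sigma) :
    (affine_val P \in plane_section C alpha) = (P \in C) && (P <= alpha)%VS.
  by rewrite mem_imset ?inE //; apply: val_inj.
have sec_card (alpha : pg_plane F 4) :
    #|plane_section C alpha| = #|[set v in D | c0 + v \in (alpha : {vspace _})]|.
  rewrite card_imset; last exact: val_inj.
  rewrite -(card_imset _ vec_inj); apply: eq_card => v; rewrite inE.
  apply/imsetP/andP => [[P]|[/imsetP[P CP ->] Pa]].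
    by rewrite inE => /andP[CP Pa] ->; rewrite vecD -vecP.
  by exists P; rewrite ?inE ?CP ?vecP.
have planeD (alpha : pg_plane F 4) x y :
    x \in (Sigma : {vspace _}) -> y \in (Sigma : {vspace _}) -> c0 + x \in (alpha : {vspace _}) ->
    (c0 + y \in (alpha : {vspace _})) = (x + y \in (alpha :&: Sigma)%VS).
  move=> Sx Sy ax; have e : x + y = (c0 + x) + (c0 + y) by rewrite addrACA add2 add0r.
  rewrite memv_cap (memvD Sx Sy) andbT e; apply/idP/idP => [ay|]; first exact: memvD.
  by move/(memvD ax); rewrite addK2.
have plane_dim (alpha : pg_plane F 4) x : x \in (Sigma : {vspace _}) ->
    c0 + x \in (alpha : {vspace _}) -> \dim (alpha :&: Sigma) = 2%N.
  move=> Sx ax; have : (alpha + Sigma)%VS = fullv.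
    apply/eqP; rewrite eqEdim subvf dimvf /dim /= mul1n.
    have Scx : c0 + x \notin (Sigma : {vspace _}).
      by apply: contra Sc0 => Scx; rewrite -(addrK x c0) memvB.
    apply: (@leq_trans (\dim (<[c0 + x]> + Sigma))).
      by rewrite dim_line_add // dim_flat.
    by rewrite dimvS // addvS // -memvE.
  have := dimv_sum_cap alpha Sigma; move=> + e; rewrite e dimvf /dim /= mul1n !dim_flat.
  by case.
have := @translation_set_structure F 5 Sigma D N char2 F_gt2 (dim_flat Sigma) DW.
have D0 : 0 \in D.
  have [P PE] := vec_onto 0 (mem0v _); rewrite -PE vecD.
  suff -> : P = P0 by [].
  by do 2!apply: val_inj; rewrite /= vecE PE addr0.
have cardD : #|D| = (#|F| ^ 2)%N by rewrite card_imset.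
case/(_ D0 cardD).
- by move=> x U [_ [alpha [_ _ ->]]]; apply: capvSr.
- by move=> x U [Sx [alpha [_ ax ->]]]; apply: plane_dim ax.
- move=> x y U [Sx [alpha [Ca ax ->]]] Uxy.
  have Sy : y \in (Sigma : {vspace _}).
    by move: Uxy; rewrite memv_cap => /andP[_ /(memvD Sx)]; rewrite addK2.
  by split=> //; exists alpha; split=> //; rewrite (planeD _ x).
- move=> x U [Sx [alpha [Ca ax ->]]]; have [<- _ _] := A1 Ca; rewrite sec_card.
  apply: eq_card => y; rewrite !inE; case: (boolP (y \in D)) => //= Dy.
  by rewrite (planeD _ x) // DW.
(* By (A2) the two points lie in a C-plane; a third C-point on their line would lie there too,
   against the arc property in (A1). *)
- move=> _ _ k /imsetP[P CP ->] /imsetP[Q CQ ->] PQ.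
  set d := _ + _ => /imsetP[R CR dE].
  have [k0|k0] := eqVneq k 0; first by left.
  have [k1|k1] := eqVneq k 1; first by right.
  have PQ' : P != Q by apply: contraNneq PQ => ->.
  have [alpha [[Ca Pa Qa] _]] := A2 CP CQ PQ'.
  have [_ _ arc] := A1 Ca.
  have ab0 : vec P + vec Q != 0 by rewrite -[vec Q]opp2 subr_eq0.
  have cRE : c0 + vec R = (c0 + vec P) + k *: ((c0 + vec P) + (c0 + vec Q)).
    by rewrite -dE /d addrA [c0 + vec P + (c0 + _)]addrACA add2 add0r.
  have PR : P != R.
    apply/eqP => PR; move: dE; rewrite -PR /d => /eqP; rewrite -[X in _ == X]addr0.
    by rewrite (inj_eq (addrI _)) scaler_eq0 (negPf k0) (negPf ab0).
  have QR : Q != R.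
    apply/eqP => QR; have : (k - 1) *: (vec P + vec Q) == 0.
      by rewrite scalerBl scale1r -(addK2 (vec P) (k *: _)) -/d dE -QR subrr.
    by rewrite scaler_eq0 subr_eq0 (negPf k1) (negPf ab0).
  have Ra : (R <= alpha)%VS.
    by move: Pa Qa; rewrite !vecP cRE => Pa Qa; rewrite (memvD Pa (memvZ _ (memvD Pa Qa))).
  have in_sec (X : affine_point Sigma) : X \in C -> (X <= alpha)%VS ->
      affine_val X \in plane_section C alpha by move=> CX Xa; rewrite sec_mem CX Xa.
  have neq (X Y : affine_point Sigma) : X != Y -> affine_val X != affine_val Y.
    by apply: contraNneq => e; apply/eqP/val_inj.
  case: (arc _ _ _ (in_sec P CP Pa) (in_sec Q CQ Qa) (in_sec R CR Ra)
             (neq _ _ PQ') (neq _ _ PR) (neq _ _ QR)).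
  have cPQ : c0 + vec P \notin <[c0 + vec Q]>%VS.
    rewrite -vecE memvE -vecE; apply: contraNN PQ' => sub; apply/eqP; do 2!apply: val_inj.
    by apply/eqP; rewrite /= eqEdim sub !dim_flat.
  have cQ0 : c0 + vec Q != 0.
    by have := dim_flat Q; rewrite vecE dim_vline; case: eqP.
  have dl : \dim (<[c0 + vec P]> + <[c0 + vec Q]>) == 2%N.
    by rewrite dim_line_add // dim_vline cQ0.
  exists (Flat dl) => /=; rewrite !vecE addvSl addvSr; split=> //.
  have lP := subvP (addvSl <[c0 + vec P]> <[c0 + vec Q]>) _ (memv_line _).
  have lQ := subvP (addvSr <[c0 + vec P]> <[c0 + vec Q]>) _ (memv_line _).
  by rewrite -memvE cRE memvD // memvZ // memvD.
- move=> _ _ /imsetP[P CP ->] /imsetP[Q CQ ->] PQ.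
  have PQ' : P != Q by apply: contraNneq PQ => ->.
  have [alpha [[Ca Pa Qa] _]] := A2 CP CQ PQ'.
  exists (alpha :&: Sigma)%VS; last by rewrite -(planeD _ (vec P)) -?vecP.
  by split=> //; exists alpha; rewrite -vecP.
- move=> _ _ U U' /imsetP[P CP ->] /imsetP[Q CQ ->] PQ.
  have PQ' : P != Q by apply: contraNneq PQ => ->.
  have [beta [_ uniq]] := A2 CP CQ PQ'.
  move=> [_ [al [Ca Pa ->]]] [_ [al' [Ca' Pa' ->]]].
  rewrite -!(planeD _ (vec P)) // => Qa Qa'.
  have <- : beta = al by apply: uniq; split; rewrite ?vecP.
  by have <- : beta = al' by apply: uniq; split; rewrite ?vecP.
- move=> x U U' Sx Dx [_ [al [Ca Pa ->]]] [_ [al' [Ca' Pa' ->]]].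
  have [P PE] := vec_onto x Sx; rewrite -PE vecD in Dx Pa Pa'.
  have [beta [_ uniq]] := A3 Dx.
  have <- : beta = al by apply: uniq; split; rewrite ?vecP.
  by have <- : beta = al' by apply: uniq; split; rewrite ?vecP.
- move=> a b d Da Db Dd ab adab.
  have Sab : a + b \in (Sigma : {vspace _}) by rewrite memvD ?DW.
  have Sad : a + d \in (Sigma : {vspace _}) by rewrite memvD ?DW.
  set V := (_ + _)%VS.
  have ab0 : a + b != 0 by rewrite -[b]opp2 subr_eq0.
  have dV : \dim V = 2%N by rewrite /V addvC dim_line_add // dim_vline ab0.
  have VS : (V <= Sigma)%VS by rewrite subv_add -!memvE Sab.
  have cV : c0 + a \notin V.
    apply: contra Sc0 => Vca; rewrite -(addrK a c0).
    exact: memvB (subvP VS _ Vca) (DW _ Da).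
  have dal : \dim (<[c0 + a]> + V) == 3%N by rewrite dim_line_add // dV.
  (* The plane through [a], [b] and [d], to which (A4) is applied. *)
  pose alpha : pg_plane F 4 := Flat dal.
  have aa : c0 + a \in (alpha : {vspace _}) := subvP (addvSl _ _) _ (memv_line _).
  have VE : V = (alpha :&: Sigma)%VS.
    by apply/eqP; rewrite eqEdim subv_cap addvSr VS dV (plane_dim _ a) ?DW.
  have secE : [set y in D | a + y \in V] = [set v in D | c0 + v \in (alpha : {vspace _})].
    apply/setP => y; rewrite !inE; case: (boolP (y \in D)) => //= Dy.
    by have := planeD alpha a y (DW _ Da) (DW _ Dy) aa; rewrite -VE => <-.
  have Vab : a + b \in V := subvP (addvSl _ _) _ (memv_line _).
  have Vad : a + d \in V := subvP (addvSr _ _) _ (memv_line _).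
  case: (A4 (alpha := alpha)).
  + rewrite sec_card -secE; apply/card_gt2P; exists a, b, d; rewrite !inE Da Db Dd.
    rewrite Vab Vad add2 mem0v; split=> //; split=> //.
      by apply: contraNneq adab => <-; rewrite memv_line.
    by apply: contraNneq adab => ->; rewrite add2 mem0v.
  + by rewrite sec_card -secE; right.
  + by move=> Ca; left; split; [exact: DW|exists alpha].
move=> theta [p [r [p' [r' [free full DE fixt]]]]].
exists theta, c0, p, r, p', r'; split=> // P.
rewrite -vecD; split=> [/DE[x [y e]]|[x [y e]]].
  by exists x, y; rewrite -e -vecE.
apply/DE; exists x, y.
set v := theta x *: p + x *: r + (theta y *: p' + y *: r') in e *.
have Sv : v \in (Sigma : {vspace _}) by apply/full; exists (theta x), x, (theta y), y.
have [Q QE] := vec_onto v Sv; rewrite -QE; congr vec.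
by do 2!apply: val_inj; rewrite /= e -QE -vecE.
Qed.

End AffineCoordinates.

(** * Coordinates over [K] and the standard form of the hyperoval *)

Lemma projectivity_image1 (K : finFieldType) (X : {set pg_point K 2}) :
  projectivity_image 1%:M X = X.
Proof.
have id1 (Q : {vspace 'rV[K]_3}) : (linfun (mulmxr 1%:M) @: Q)%VS = Q.
  rewrite (@eq_in_limg _ _ _ _ _ \1%VF) ?lim1g // => w _.
  by rewrite id_lfunE lfunE /= mulmx1.
apply/setP => P; rewrite inE; apply/existsP/idP => [[Q /andP[XQ /eqP PQ]]|XP].
  by rewrite (_ : P = Q) //; apply: val_inj; rewrite /= PQ id1.
by exists P; rewrite XP id1 eqxx.
Qed.

(* The [F]-space [V(5, q)] maps onto the vectors of [K^3] with last coordinate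
   in [F] so that [C] becomes [{(t^(2^n), t, 1)}]: since [x |-> x^(2^n)] extends
   [theta], the coefficient of [p'] must be the [2^n]-th power of that of [r']. *)
Lemma semilinear_model (F K : finFieldType) (Sigma : pg_solid F 4)
    (theta : {rmorphism F -> F}) (phi : {rmorphism F -> K}) (n : nat)
    (c0 p r p' r' : 'rV[F]_5) :
  2%N \in [pchar K] -> #|K| = (#|F| ^ 2)%N ->
  (forall x, phi (theta x) = phi x ^+ (2 ^ n)) ->
  c0 \notin (Sigma : {vspace _}) ->
  (forall a b c d, a *: p + b *: r + (c *: p' + d *: r') = 0 ->
     [/\ a = 0, b = 0, c = 0 & d = 0]) ->
  (forall w, w \in (Sigma : {vspace _}) <->
     exists a b c d, w = a *: p + b *: r + (c *: p' + d *: r')) ->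
  exists Psi : 'rV[F]_5 -> 'rV[K]_3,
  [/\ {morph Psi : u v / u + v} /\ forall a u, Psi (a *: u) = phi a *: Psi u,
      forall u, Psi u = 0 -> u = 0,
      forall u, (u \in (Sigma : {vspace _})) = (Psi u \in line_inf K),
      forall w : 'rV[K]_3, w 0 ord_max = 0 \/ w 0 ord_max = 1 -> exists u, Psi u = w
    & exists2 v : K -> 'rV[F]_5,
        (forall t, exists x y, v t =
           c0 + (theta x *: p + x *: r + (theta y *: p' + y *: r'))) /\
        (forall x y, exists t,
           c0 + (theta x *: p + x *: r + (theta y *: p' + y *: r')) = v t)
      & forall t, Psi (v t) = vec3 (t ^+ (2 ^ n)) t 1].
Proof.
move=> char2 cardK phi_th Sc0 free full.
have [om [om_free om_gen]] := quadratic_basis phi cardK.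
have powD (x y : K) : (x + y) ^+ (2 ^ n) = x ^+ (2 ^ n) + y ^+ (2 ^ n).
  by apply: exprDn_pchar; rewrite pnatX pnatE // char2.
have pow_inj : injective (fun x : K => x ^+ (2 ^ n)).
  move=> x y /= e; apply/eqP; rewrite -subr_eq0 (oppr_pchar2 char2).
  have : (x + y) ^+ (2 ^ n) = 0.
    by rewrite powD e -{2}[y ^+ _](oppr_pchar2 char2) subrr.
  by move/eqP; rewrite expf_eq0 expn_gt0.
have pow_onto (x : K) : exists t, x = t ^+ (2 ^ n).
  by have /codomP[t ->] := injF_onto pow_inj x; exists t.
have pow_om x y : (phi x + phi y * om) ^+ (2 ^ n) =
    phi (theta x) + phi (theta y) * om ^+ (2 ^ n).
  by rewrite powD exprMn !phi_th.
have th_onto x : exists y, x = theta y.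
  by have /codomP[y ->] := injF_onto (fmorph_inj theta) x; exists y.
(* The power map is an additive bijection of [K] inducing theta on [F], so it carries the basis 1,
   [om] over [F] to another basis. *)
have om_free' a c : phi a + phi c * om ^+ (2 ^ n) = 0 -> a = 0 /\ c = 0.
  have [x ->] := th_onto a; have [y ->] := th_onto c.
  rewrite -pow_om => /eqP; rewrite expf_eq0 expn_gt0 /= => /eqP/om_free[-> ->].
  by rewrite rmorph0.
have om_gen' t : exists a c, t = phi a + phi c * om ^+ (2 ^ n).
  have [s ->] := pow_onto t; have [x [y ->]] := om_gen s.
  by exists (theta x), (theta y); rewrite pow_om.
pose S a b c d := a *: p + b *: r + (c *: p' + d *: r').
have S_in a b c d : S a b c d \in (Sigma : {vspace _}) by apply/full; exists a, b, c, d.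
have SB a b c d a1 b1 c1 d1 :
    S a b c d - S a1 b1 c1 d1 = S (a - a1) (b - b1) (c - c1) (d - d1).
  by rewrite /S !scalerBl opprD addrACA !opprD ![_ + _ + (- _ - _)]addrACA.
have fullE : (<[c0]> + Sigma)%VS = fullv.
  by apply/eqP; rewrite eqEdim subvf dim_line_add // dimvf /dim /= mul1n dim_flat.
have rep (u : 'rV[F]_5) : exists t : F * (F * F * (F * F)),
    u = t.1 *: c0 + S t.2.1.1 t.2.1.2 t.2.2.1 t.2.2.2.
  have : u \in (<[c0]> + Sigma)%VS by rewrite fullE memvf.
  case/memv_addP => _ /vlineP[z ->] [s /full[a [b [c [d ->]]]] ->].
  by exists (z, ((a, b), (c, d))).
have c0_free z a b c d : z *: c0 + S a b c d = 0 -> [/\ z = 0, a = 0, b = 0, c = 0 & d = 0].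
  have [->|z0 e] := eqVneq z 0.
    by rewrite scale0r add0r => /free[-> -> -> ->].
  case/negP: Sc0; rewrite -[c0]scale1r -(mulVf z0) -scalerA memvZ //.
  by rewrite -[z *: c0]opprK (addr0_eq e) memvN.
have [co coE] := fin_all_exists rep.
(* The pair p, p' is read in the basis 1, [om ^+ (2 ^ n)] and the pair r, r' in the basis 1,
   [om]. *)
pose psi z a b c d : 'rV[K]_3 :=
  vec3 (phi a + phi c * om ^+ (2 ^ n)) (phi b + phi d * om) (phi z).
pose Psi u := let t := co u in psi t.1 t.2.1.1 t.2.1.2 t.2.2.1 t.2.2.2.
have PsiE z a b c d : Psi (z *: c0 + S a b c d) = psi z a b c d.
  rewrite /Psi; set u := _ + _; have := coE u.
  case: (co u) => z1 [[a1 b1] [c1 d1]] /= /eqP.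
  rewrite {1}/u -subr_eq0 opprD addrACA -scalerBl SB => /eqP/c0_free[].
  by do 5!move=> /subr0_eq ->.
have PsiP u : exists z a b c d, u = z *: c0 + S a b c d.
  by rewrite (coE u); do 5!eexists.
exists Psi; split.
- split=> [u v|k u].
    have [z [a [b [c [d ->]]]]] := PsiP u; have [z1 [a1 [b1 [c1 [d1 ->]]]]] := PsiP v.
    have -> : z *: c0 + S a b c d + (z1 *: c0 + S a1 b1 c1 d1) =
        (z + z1) *: c0 + S (a + a1) (b + b1) (c + c1) (d + d1).
      rewrite addrACA scalerDl; congr (_ + _).
      by rewrite /S !scalerDl [LHS]addrACA; congr (_ + _); rewrite addrACA.
    rewrite !PsiE /psi -[vec3 _ _ _ in X in _ = X + _]scale1r vec3_lincomb.
    rewrite !mul1r !rmorphD /= !mulrDl.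
    by congr vec3; rewrite addrACA.
  have [z [a [b [c [d ->]]]]] := PsiP u.
  have -> : k *: (z *: c0 + S a b c d) = (k * z) *: c0 + S (k * a) (k * b) (k * c) (k * d).
    by rewrite /S !scalerDr !scalerA.
  by rewrite !PsiE /psi vec3Z !mulrDr !rmorphM !mulrA.
- move=> u; have [z [a [b [c [d ->]]]]] := PsiP u; rewrite PsiE.
  rewrite -(scale0r (vec3 0 0 0)) vec3Z !mulr0 => /vec3_inj[/om_free'[-> ->] /om_free[-> ->]].
  by move=> /eqP; rewrite fmorph_eq0 => /eqP ->; rewrite /S !scale0r !addr0.
- move=> u; have [z [a [b [c [d ->]]]]] := PsiP u; rewrite PsiE mem_line_inf vec3_max.
  rewrite fmorph_eq0; apply/idP/eqP => [Su|->]; last by rewrite scale0r add0r.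
  apply: contraNeq Sc0 => z0.
  rewrite -[c0]scale1r -(mulVf z0) -scalerA memvZ //.
  by rewrite -(addrK (S a b c d) (z *: c0)) memvB.
- move=> w w01; have [a [c aE]] := om_gen' (w 0 0); have [b [d bE]] := om_gen (w 0 1).
  have [z zE] : exists z, w 0 ord_max = phi z.
    by case: w01 => ->; [exists 0; rewrite rmorph0|exists 1; rewrite rmorph1].
  by exists (z *: c0 + S a b c d); rewrite PsiE [RHS]vec3_eta aE bE zE.
have om_gen2 t : exists xy : F * F, t = phi xy.1 + phi xy.2 * om.
  by have [x [y ->]] := om_gen t; exists (x, y).
have [xy xyE] := fin_all_exists om_gen2.
(* The parameters x, y of a point of [C] are the coordinates of [t] in the basis 1, [om]. *)
exists (fun t => c0 + S (theta (xy t).1) (xy t).1 (theta (xy t).2) (xy t).2).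
  split=> [t|x y]; first by exists (xy t).1, (xy t).2.
  exists (phi x + phi y * om); have := xyE (phi x + phi y * om).
  move/eqP; rewrite -subr_eq0 opprD addrACA -mulrBl -!rmorphB => /eqP/om_free[].
  by move=> /eqP + /eqP; rewrite !subr_eq0 => /eqP <- /eqP <-.
by move=> t; rewrite -{1}[c0]scale1r PsiE /psi -pow_om rmorph1 -xyE.
Qed.

Local Close Scope ring_scope.

Theorem theorem1p2 (q h : nat) (F K : finFieldType)
  (cardF : #|F| = q) (cardK : #|K| = q ^ 2)
  (q_even : ~~ odd q) (q_gt2 : 2 < q) (q_pow : q = 2 ^ h)
  (Sigma : pg_solid F 4)
  (C : {set affine_point Sigma}) (cardC : #|C| = q ^ 2)
  (Cplanes : {set pg_plane F 4})
  (A1 : forall alpha, alpha \in Cplanes -> is_arc q alpha (plane_section C alpha))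
  (A2 : forall P Q, P \in C -> Q \in C -> P != Q ->
     exists! alpha, [/\ alpha \in Cplanes, (P <= alpha)%VS & (Q <= alpha)%VS])
  (A3 : forall P : affine_point Sigma, P \notin C ->
     exists! alpha, alpha \in Cplanes /\ (P <= alpha)%VS)
  (A4 : forall alpha : pg_plane F 4, 3 <= #|plane_section C alpha| ->
     #|plane_section C alpha| = 4 \/ alpha \in Cplanes) :
  exists S : {set pg_line F 4}, is_regular_spread Sigma S /\
  exists (f : ipoint (bruck_bose Sigma S) -> ipoint (PG2 K))
         (g : iline (bruck_bose Sigma S) -> iline (PG2 K)),
    is_isomorphism f g /\
  exists A B : spread_line S, A != B /\
    is_translation_hyperoval h (f @: with_two_infinite_points C A B).
Proof.
subst q.
have h_gt0 : 0 < h by case: (h) q_pow q_gt2 => // ->.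
have charF : 2 \in [pchar F]%R := card_finPcharP q_pow isT.
have charK : 2 \in [pchar K]%R.
  by apply: (@card_finPcharP _ 2 (h * 2)) => //; rewrite cardK q_pow -expnM.
have [theta [c0 [p [r [p' [r' [Sc0 free full CE fixt]]]]]]] :=
  affine_coordinates charF q_gt2 cardC A1 A2 A3 A4.
have [phi [n [gcdn1 phi_th]]] := embedding_twist q_pow h_gt0 cardK fixt.
have [Psi [[PsiD PsiZ] Psi0 Psi_inf Psi_onto [v [vE vS] Psiv]]] :=
  semilinear_model charK cardK phi_th Sc0 free full.
have reg := pullback_is_regular cardK PsiD PsiZ Psi0 Psi_inf Psi_onto.
have [f [g [fg f_aff f_inf]]] :=
  bruck_bose_isomorphism cardK PsiD PsiZ Psi0 Psi_inf Psi_onto.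
exists (pullback_spread Psi); split=> //; exists f, g; split=> //.
(* The two extra points are (1, 0, 0) and (0, 1, 0), the points at infinity of the standard
   hyperoval. *)
have [X XE] := point_of_vector (inf_vector_neq0 (Some (0 : K)%R)).
have [Y YE] := point_of_vector (inf_vector_neq0 (None : option K)).
have [|A fA] := f_inf X; first by rewrite XE inf_vector_inf.
have [|B fB] := f_inf Y; first by rewrite YE inf_vector_inf.
exists A, B; split.
  apply/eqP => AB; have : Some (0 : K)%R = None.
    by apply: inf_vector_inj; rewrite -XE -YE -fA -fB AB.
  by [].
(* [Psi] was built to give the standard form itself, so the projectivity is the identity. *)
exists n; split=> //; exists 1%:M%R; first exact: unitmx1.
rewrite projectivity_image1; apply/setP => Q; rewrite inE.
apply/imsetP/or3P => [[x]|].
  rewrite !inE => /or3P[/imsetP[P CP ->]|/eqP->|/eqP->] ->.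
  - constructor 1; apply/existsP; have [x1 [y1 PE]] := (CE P).1 CP.
    have [t tE] := vS x1 y1; exists t.
    by rewrite (f_aff _ _ PE) tE Psiv.
  - by constructor 2; rewrite fA XE.
  - by constructor 3; rewrite fB YE.
case=> [/existsP[t /eqP Qt]|/eqP QX|/eqP QY].
- have [x1 [y1 vt]] := vE t.
  have Svt : v t \notin (Sigma : {vspace _}).
    by rewrite Psi_inf Psiv mem_line_inf vec3_max GRing.oner_eq0.
  have [|P PE] := @point_of_vector _ _ (v t).
    by apply: contraNneq Svt => ->; rewrite mem0v.
  have aP : ~~ (P <= Sigma)%VS by rewrite PE -memvE.
  exists (inl (AffinePoint aP)).
    rewrite !inE imset_f //.
    by apply/CE; exists x1, y1; rewrite -vt.
  by apply: val_inj; rewrite /= (f_aff (AffinePoint aP) _ PE) Psiv.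
- by exists (inr A); rewrite ?inE ?eqxx ?orbT // fA; apply: val_inj; rewrite /= QX XE.
- by exists (inr B); rewrite ?inE ?eqxx ?orbT // fB; apply: val_inj; rewrite /= QY YE.
Qed.
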